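(* Let $m\ge 1$, $1\le p<\infty$, let $X$ be any one of the four sets $\widetilde{S}^{m,p}$, $E^{m,p}$, $S_0^{m,p}$, $S^{m,p}$, and let $U\subset X$. Let $\overline{U}$ denote the closure of $U$ in $(F_B(\mathbb{R}^m)^p,d_p)$. Then $U$ is compact in $(X,d_p)$ if and only if (i) $U$ is uniformly $p$-mean bounded; (ii) $U$ is $p$-mean equi-left-continuous; and (iii) $U=\overline{U}$.
   Context: $H$ is the Hausdorff metric on nonempty closed subsets of $\mathbb{R}^m$ (Euclidean distance): $H(A,B)=\max\{\sup_{a\in A}\inf_{b\in B}d(a,b),\ \sup_{b\in B}\inf_{a\in A}d(a,b)\}$ (possibly $+\infty$). A fuzzy set on $\mathbb{R}^m$ is a function $u:\mathbb{R}^m\to[0,1]$; its cuts are $[u]_\alpha=\{x: u(x)\ge\alpha\}$ for $\alpha\in(0,1]$ and $[u]_0=\overline{\{x: u(x)>0\}}$. $F_B(\mathbb{R}^m)^p$ is the set of fuzzy sets $u$ on $\mathbb{R}^m$ that are normal ($u(x_0)=1$ for some $x_0$), upper semi-continuous, and satisfy $\left(\int_0^1 H([u]_\alpha,\{0\})^p\,d\alpha\right)^{1/p}<+\infty$, where $0$ is the origin. The metric is $d_p(u,v)=\left(\int_0^1 H([u]_\alpha,[v]_\alpha)^p\,d\alpha\right)^{1/p}$. Subsets of $F_B(\mathbb{R}^m)^p$: - $E^{m,p}$: those $u$ that are fuzzy convex, i.e. $u(\lambda x+(1-\lambda)y)\ge\min\{u(x),u(y)\}$ for all $x,y\in\mathbb{R}^m$,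 $\lambda\in[0,1]$; - $S_0^{m,p}$: those $u$ with $u(\lambda y)\ge u(y)$ for all $y\in\mathbb{R}^m$, $\lambda\in[0,1]$; - $S^{m,p}$: those $u$ for which there is $x\in\mathbb{R}^m$ with $u(\lambda y+(1-\lambda)x)\ge u(y)$ for all $y\in\mathbb{R}^m$, $\lambda\in[0,1]$; - $\widetilde{S}^{m,p}$: those $u$ such that for every $\alpha\in(0,1]$ there is $x_\alpha\in[u]_\alpha$ such that for all $y\in[u]_\alpha$ the segment $\overline{x_\alpha y}$ is contained in $[u]_\alpha$. A set $U\subset F_B(\mathbb{R}^m)^p$ is uniformly $p$-mean bounded if there is $M>0$ with $d_p(u,\widehat{0})\le M$ for all $u\in U$, where $\widehat 0$ is the characteristic function of $\{0\}$. $U$ is $p$-mean equi-left-continuous if for every $\varepsilon>0$ there is $\delta>0$ such that for all $0\le h<\delta$ and all $u\in U$, $\left(\int_h^1 H([u]_\alpha,[u]_{\alpha-h})^p\,d\alpha\right)^{1/p}<\varepsilon$. *)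

(* Defs.v *)
From HB Require Import structures.
From mathcomp Require Import all_boot all_order all_algebra.
From mathcomp Require Import all_classical all_reals all_analysis.
Set Implicit Arguments.
Unset Strict Implicit.
Unset Printing Implicit Defensive.
Import Order.TTheory GRing.Theory Num.Theory.
Import numFieldNormedType.Exports.
Local Open Scope classical_set_scope.
Local Open Scope ring_scope.

(* The library norm on 'rV[R]_m is the sup norm, so
   the Euclidean distance is defined here; the library topology on 'rV[R]_m is
   the Euclidean one. *)
Definition eucl_dist (R : realType) (m : nat) (x y : 'rV[R]_m) : R :=
  Num.sqrt (\sum_(i < m) (x 0 i - y 0 i) ^+ 2).

Definition hausdorff_dist (R : realType) (m : nat) (A B : set 'rV[R]_m) : \bar R :=
  maxe
    (ereal_sup [set ereal_inf [set (eucl_dist a b)%:E | b in B] | a in A])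
    (ereal_sup [set ereal_inf [set (eucl_dist a b)%:E | a in A] | b in B]).

Record fuzzy_set (R : realType) (m : nat) := FuzzySet {
  memb :> 'rV[R]_m -> R ;
  memb_itv : forall x, 0 <= memb x <= 1 }.

HB.instance Definition _ (R : realType) (m : nat) := gen_eqMixin (fuzzy_set R m).
HB.instance Definition _ (R : realType) (m : nat) := gen_choiceMixin (fuzzy_set R m).

(* Only used for 0 <= alpha <= 1. *)
Definition alpha_cut (R : realType) (m : nat) (u : fuzzy_set R m) (alpha : R) :
    set 'rV[R]_m :=
  if 0 < alpha then [set x | alpha <= u x] else closure [set x | 0 < u x].

Lemma hat0_itv (R : realType) (m : nat) (x : 'rV[R]_m) :
  0 <= (\1_[set (0 : 'rV[R]_m)] x : R) <= 1.
Proof. by rewrite indicE; case: (_ \in _); rewrite /= ?lexx ler01. Qed.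

Definition hat0 (R : realType) (m : nat) : fuzzy_set R m :=
  FuzzySet (@hat0_itv R m).

Definition upper_semicontinuous (R : realType) (T : topologicalType) (f : T -> R) :=
  forall x a, f x < a -> \forall y \near x, f y < a.

Definition normal_fuzzy (R : realType) (m : nat) (u : fuzzy_set R m) :=
  exists x0, u x0 = 1.

Section Lp.
Context (R : realType) (m : nat) (p : R).
Implicit Types (u v : fuzzy_set R m) (U X : set (fuzzy_set R m)).
Local Open Scope ereal_scope.

(* (\int_a^1 (g alpha)^p d alpha)^(1/p), with +oo allowed as a value *)
Definition Lp_from (a : R) (g : R -> \bar R) : \bar R :=
  (\int[lebesgue_measure]_(alpha in `[a, 1%R]) (g alpha `^ p)) `^ p^-1.

Definition dp u v : \bar R :=
  Lp_from 0 (fun alpha => hausdorff_dist (alpha_cut u alpha) (alpha_cut v alpha)).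

Definition FB : set (fuzzy_set R m) := [set u |
  [/\ normal_fuzzy u, upper_semicontinuous u &
    Lp_from 0 (fun alpha => hausdorff_dist (alpha_cut u alpha) [set 0%R]) < +oo ]].

Local Open Scope ring_scope.

Definition E_mp : set (fuzzy_set R m) := [set u | FB u /\
  forall (x y : 'rV[R]_m) (l : R), 0 <= l <= 1 ->
    Num.min (u x) (u y) <= u (l *: x + (1 - l) *: y)].

Definition S0_mp : set (fuzzy_set R m) := [set u | FB u /\
  forall (y : 'rV[R]_m) (l : R), 0 <= l <= 1 -> u y <= u (l *: y)].

Definition S_mp : set (fuzzy_set R m) := [set u | FB u /\
  exists x : 'rV[R]_m, forall (y : 'rV[R]_m) (l : R), 0 <= l <= 1 ->
    u y <= u (l *: y + (1 - l) *: x)].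

Definition segment (x y : 'rV[R]_m) : set 'rV[R]_m :=
  [set l *: y + (1 - l) *: x | l in `[0, 1]].

Definition Stilde_mp : set (fuzzy_set R m) := [set u | FB u /\
  forall alpha : R, 0 < alpha <= 1 ->
    exists2 x, alpha_cut u alpha x &
      forall y, alpha_cut u alpha y -> segment x y `<=` alpha_cut u alpha].

Definition uniformly_p_mean_bounded U :=
  exists2 M : R, 0 < M & forall u, U u -> (dp u (hat0 R m) <= M%:E)%E.

(* For h > 1 the interval [h, 1] is empty and the condition is void. *)
Definition p_mean_equi_left_continuous U :=
  forall eps : R, 0 < eps -> exists2 delta : R, 0 < delta &
    forall h : R, 0 <= h < delta -> forall u, U u ->
      (Lp_from h (fun alpha => hausdorff_dist (alpha_cut u alpha) (alpha_cut u (alpha - h)))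
         < eps%:E)%E.

End Lp.

(* The set X as a type of its own, to carry the topology of (X, d_p); the
   exponent p is a parameter of the type because the topology depends on it. *)
Definition dp_space (R : realType) (m : nat) (p : R)
  (X : set (fuzzy_set R m)) : Type := {u : fuzzy_set R m | X u}.

Section dp_topology.
Context (R : realType) (m : nat) (p : R) (X : set (fuzzy_set R m)).

HB.instance Definition _ := gen_eqMixin (dp_space p X).
HB.instance Definition _ := gen_choiceMixin (dp_space p X).

Definition dp_open (A : set (dp_space p X)) :=
  forall u : dp_space p X, A u -> exists2 e : R, 0 < e &
    forall v : dp_space p X, (dp p (sval u) (sval v) < e%:E)%E -> A v.

Lemma dp_openT : dp_open [set: dp_space p X].
Proof. by move=> u _; exists 1. Qed.

Lemma dp_openI : setI_closed dp_open.
Proof.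
move=> A B oA oB u [/oA[e e0 eA] /oB[f f0 fB]].
exists (Num.min e f); first by rewrite lt_min e0.
move=> v; rewrite EFin_min lt_min => /andP[ve vf].
by split; [exact: eA | exact: fB].
Qed.

Lemma dp_open_bigU (I : Type) (f : I -> set (dp_space p X)) :
  (forall i, dp_open (f i)) -> dp_open (\bigcup_i f i).
Proof.
move=> of_ u [i _ /of_[e e0 ef]]; exists e => // v /ef fv.
by exists i.
Qed.

(* Opens are given through balls so that no triangle inequality for d_p is
   needed to obtain a topology. *)
HB.instance Definition _ :=
  isOpenTopological.Build (dp_space p X) dp_openT dp_openI dp_open_bigU.

(* U as a subset of the space (X, d_p). *)
Definition in_space (U : set (fuzzy_set R m)) : set (dp_space p X) :=
  [set u | U (sval u)].

End dp_topology.

Arguments in_space {R m} p X U.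

(* Main.v *)
(* A nonempty set is encoded by its distance function. The Hausdorff distance of
   two sets is the supremum of the difference of their distance functions, and
   those of the cuts of a fuzzy set are monotone in the level, so that everything
   reduces to monotone real functions. The integrals of H^p satisfy the triangle
   inequality up to the factor 2^p, which is enough for the topology and avoids
   Minkowski's inequality.

   Sufficiency: along an ultrafilter on U the distance functions of the cuts
   converge at every level, because the cuts at a positive level are uniformly
   bounded; the limits are the distance functions of a nested family of compact
   sets, which defines a fuzzy set v. Away from the level 0, monotonicity in the
   level upgrades pointwise to L^p convergence. Near 0 the integrals are uniformly
   small, and this is what equi-left-continuity provides. So v is in the closure
   of U, hence in U.

   Necessity: boundedness and equi-left-continuity hold for a single fuzzy set and
   persist in its neighbourhoods, thus on compact sets.

   The class X only enters through its inclusion in F_B(R^m)^p. *)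
Require Import Defs.
From HB Require Import structures.
From mathcomp Require Import all_boot all_order all_algebra.
From mathcomp Require Import all_classical all_reals all_analysis.
From mathcomp Require Import measurable_realfun ring lra.
Import Order.TTheory GRing.Theory Num.Theory.
Import numFieldNormedType.Exports.
Set Implicit Arguments.
Unset Strict Implicit.
Unset Printing Implicit Defensive.
Local Open Scope classical_set_scope.
Local Open Scope ring_scope.

(** * Hausdorff distance through distance functions *)

Section euclidean_distance.
Context (R : realType) (m : nat).
Implicit Types (x y z c : 'rV[R]_m) (A B C : set 'rV[R]_m).

Lemma eucl_dist_ge0 x y : 0 <= eucl_dist x y.
Proof. exact: sqrtr_ge0. Qed.

Lemma eucl_distxx x : eucl_dist x x = 0.
Proof. by rewrite /eucl_dist big1 ?sqrtr0// => i _; rewrite subrr expr0n. Qed.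

Lemma eucl_distC x y : eucl_dist x y = eucl_dist y x.
Proof. by congr Num.sqrt; apply: eq_bigr => i _; rewrite -sqrrN opprB. Qed.

(* Lagrange's identity, bounding the difference of the two sides below by 0 *)
Lemma sum_mul_sqr_le (a b : 'I_m -> R) :
  (\sum_i a i * b i) ^+ 2 <= (\sum_i a i ^+ 2) * (\sum_i b i ^+ 2).
Proof.
have : 0 <= \sum_i \sum_j (a i * b j - a j * b i) ^+ 2.
  by apply: sumr_ge0 => i _; apply: sumr_ge0 => j _; exact: sqr_ge0.
suff -> : \sum_i \sum_j (a i * b j - a j * b i) ^+ 2 =
    2 * ((\sum_i a i ^+ 2) * (\sum_i b i ^+ 2)) - 2 * (\sum_i a i * b i) ^+ 2.
  by rewrite subr_ge0 ler_pM2l.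
have -> : \sum_i \sum_j (a i * b j - a j * b i) ^+ 2 =
    \sum_i \sum_j (a i ^+ 2 * b j ^+ 2) + \sum_i \sum_j (a j ^+ 2 * b i ^+ 2)
    - 2 * \sum_i \sum_j ((a i * b i) * (a j * b j)).
  rewrite mulr_sumr -big_split -sumrB /=; apply: eq_bigr => i _.
  rewrite mulr_sumr -big_split -sumrB /=; apply: eq_bigr => j _; ring.
rewrite [X in _ + X - _]exchange_big /= expr2 !big_distrlr /=; ring.
Qed.

Lemma eucl_dist_triangle y x z :
  eucl_dist x z <= eucl_dist x y + eucl_dist y z.
Proof.
rewrite -(@ler_pXn2r _ 2) ?nnegrE ?addr_ge0 ?eucl_dist_ge0//.
have sum_ge0 a b : 0 <= \sum_(i < m) (a i - b i : R) ^+ 2.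
  by apply: sumr_ge0 => i _; exact: sqr_ge0.
rewrite sqrrD !sqr_sqrtr//.
set s := \sum_(i < m) (x 0 i - y 0 i) * (y 0 i - z 0 i).
have -> : \sum_(i < m) (x 0 i - z 0 i) ^+ 2 =
    \sum_(i < m) (x 0 i - y 0 i) ^+ 2 + s *+ 2
    + \sum_(i < m) (y 0 i - z 0 i) ^+ 2.
  rewrite -sumrMnl -!big_split /=; apply: eq_bigr => i _; ring.
rewrite lerD2r lerD2l lerMn2r /= -sqrtrM//.
apply: (le_trans (ler_norm _)); rewrite -sqrtr_sqr ler_wsqrtr//.
exact: sum_mul_sqr_le.
Qed.

Lemma le_coord_eucl_dist x y i : `|x 0 i - y 0 i| <= eucl_dist x y.
Proof.
rewrite -sqrtr_sqr ler_wsqrtr// (bigD1 i)//= lerDl.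
by apply: sumr_ge0 => j _; exact: sqr_ge0.
Qed.

Lemma eucl_dist_le_sum x y : eucl_dist x y <= \sum_i `|x 0 i - y 0 i|.
Proof.
(* The invariant survives addition because the cross term of the square is nonnegative. *)
pose P (s t : R) := 0 <= t /\ s <= t ^+ 2.
have [t0 st] : P (\sum_i (x 0 i - y 0 i) ^+ 2) (\sum_i `|x 0 i - y 0 i|).
  apply: big_ind2 => [|s t s' t' [t0 st] [t'0 st']|i _].
  - by split; rewrite ?expr0n.
  - by split; [exact: addr_ge0|nra].
  - by rewrite /P normr_ge0 real_normK ?num_real.
by rewrite -(ger0_norm t0) -sqrtr_sqr ler_wsqrtr.
Qed.

(** The topology comes from the sup norm. Its balls and the Euclidean ones are compared by
    [le_coord_eucl_dist] in one direction and by [eucl_dist_le_sum] in the other. *)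
Lemma nbhs_eucl_distP x (A : set 'rV[R]_m) :
  nbhs x A <-> exists2 e : R, 0 < e & forall y, eucl_dist x y < e -> A y.
Proof.
split=> [/nbhs_ballP[e /= e0 xeA]|[e e0 xeA]].
  exists e => // y xye; apply: xeA; split => // i j.
  rewrite ord1 /ball /=; exact: le_lt_trans (le_coord_eucl_dist _ _ _) xye.
(* Dividing by [m.+1] instead of [m] keeps the radius positive and the final bound strict, also for
   [m = 0]. *)
apply/nbhs_ballP; exists (e / m.+1%:R) => /=; first by rewrite divr_gt0.
move=> y [_ xy]; apply: xeA; apply: (le_lt_trans (eucl_dist_le_sum _ _)).
apply: (@le_lt_trans _ _ (\sum_(i < m) (e / m.+1%:R))).
  by apply: ler_sum => i _; apply/ltW; exact: xy.
rewrite sumr_const card_ord -[ltLHS]mulr_natr mulrAC ltr_pdivrMr//.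
by rewrite ltr_pM2l// ltr_nat.
Qed.

(** Real-valued, with default value 0 on the empty set; hence the nonemptiness assumptions below. *)
Definition setdist A c : R := inf [set eucl_dist c a | a in A].

Let setdist_has_lbound A c : has_lbound [set eucl_dist c a | a in A].
Proof. by exists 0 => _ [a _ <-]; exact: eucl_dist_ge0. Qed.

Lemma setdist_le A c a : A a -> setdist A c <= eucl_dist c a.
Proof. by move=> Aa; apply: ge_inf => //; exists a. Qed.

Lemma le_setdist A c r : A !=set0 -> (forall a, A a -> r <= eucl_dist c a) ->
  r <= setdist A c.
Proof.
move=> [a Aa] h; apply: lb_le_inf; first by exists (eucl_dist c a), a.
by move=> _ [b Ab <-]; exact: h.
Qed.

Lemma setdist_ge0 A c : A !=set0 -> 0 <= setdist A c.
Proof. by move=> A0; apply: le_setdist => // a _; exact: eucl_dist_ge0. Qed.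

Lemma setdist_lt A c r : A !=set0 -> setdist A c < r ->
  exists2 a, A a & eucl_dist c a < r.
Proof.
move=> A0 Acr; apply: contrapT => h; move: Acr; apply/negP; rewrite -leNgt.
by apply: le_setdist => // a Aa; rewrite leNgt; apply/negP => car; apply: h; exists a.
Qed.

Lemma setdist_mem A a : A a -> setdist A a = 0.
Proof.
move=> Aa; apply/eqP; rewrite eq_le setdist_ge0; last by exists a.
by rewrite andbT -(eucl_distxx a) setdist_le.
Qed.

Lemma setdist_triangle A c d : A !=set0 ->
  setdist A c <= eucl_dist c d + setdist A d.
Proof.
move=> A0; rewrite -lerBlDl; apply: le_setdist => // a Aa; rewrite lerBlDl.
exact: le_trans (setdist_le _ Aa) (eucl_dist_triangle _ _ _).
Qed.

Lemma setdist_subset A B c : A !=set0 -> A `<=` B -> setdist B c <= setdist A c.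
Proof. by move=> A0 AB; apply: le_setdist => // a /AB; exact: setdist_le. Qed.

Lemma setdist1 a c : setdist [set a] c = eucl_dist c a.
Proof. by rewrite /setdist image_set1 inf1. Qed.

Lemma ereal_inf_eucl_dist A c : A !=set0 ->
  ereal_inf [set (eucl_dist c a)%:E | a in A] = (setdist A c)%:E.
Proof.
move=> [a Aa]; rewrite -ereal_inf_EFin//; last by exists (eucl_dist c a), a.
by rewrite -image_comp.
Qed.

Lemma hausdorff_distE A B : A !=set0 -> B !=set0 ->
  hausdorff_dist A B = maxe (ereal_sup [set (setdist B a)%:E | a in A])
                            (ereal_sup [set (setdist A b)%:E | b in B]).
Proof.
move=> A0 B0; congr (maxe (ereal_sup _) (ereal_sup _)).
  by apply: eq_imagel => a _; exact: ereal_inf_eucl_dist.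
apply: eq_imagel => b _; rewrite -ereal_inf_eucl_dist//.
by congr ereal_inf; apply: eq_imagel => a _; rewrite eucl_distC.
Qed.

Lemma hausdorff_dist_le A B (r : \bar R) : A !=set0 -> B !=set0 ->
  (forall a, A a -> ((setdist B a)%:E <= r)%E) ->
  (forall b, B b -> ((setdist A b)%:E <= r)%E) -> (hausdorff_dist A B <= r)%E.
Proof.
move=> A0 B0 rA rB; rewrite hausdorff_distE// ge_max; apply/andP.
by split; apply: ge_ereal_sup => _ [x + <-]; [exact: rA|exact: rB].
Qed.

Lemma setdist_le_hausdorff A B a : B !=set0 -> A a ->
  ((setdist B a)%:E <= hausdorff_dist A B)%E.
Proof.
move=> B0 Aa; rewrite hausdorff_distE//; last by exists a.
by rewrite le_max ereal_sup_ubound//; exists a.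
Qed.

Lemma hausdorff_distC A B : hausdorff_dist A B = hausdorff_dist B A.
Proof.
rewrite /hausdorff_dist maxC; congr (maxe (ereal_sup _) (ereal_sup _)).
  apply: eq_imagel => b _; congr ereal_inf; apply: eq_imagel => a _.
  by rewrite eucl_distC.
apply: eq_imagel => b _; congr ereal_inf; apply: eq_imagel => a _.
by rewrite eucl_distC.
Qed.

(** For [a] in [A], [setdist B c] is at most [eucl_dist c a + setdist B a], whose second term is
    below the Hausdorff distance. Take the infimum over [a]. *)
Let setdistB_le_hausdorff A B c : A !=set0 -> B !=set0 ->
  ((setdist B c - setdist A c)%:E <= hausdorff_dist A B)%E.
Proof.
move=> A0 B0; case E: (hausdorff_dist A B) => [r| |]; last 2 first.
- by rewrite leey.
- by case: A0 => a /(setdist_le_hausdorff B0); rewrite E.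
rewrite lee_fin lerBlDl -lerBlDr; apply: le_setdist => // a Aa.
rewrite lerBlDr; apply: (le_trans (setdist_triangle _ a B0)); rewrite lerD2l.
by rewrite -lee_fin -E setdist_le_hausdorff.
Qed.

Lemma setdist_dist_le_hausdorff A B c : A !=set0 -> B !=set0 ->
  (`|setdist A c - setdist B c|%:E <= hausdorff_dist A B)%E.
Proof.
move=> A0 B0; case: ger0P => _; last by rewrite opprB setdistB_le_hausdorff.
by rewrite hausdorff_distC setdistB_le_hausdorff.
Qed.

(** At a point [c] of one of the sets, one of the two distances vanishes and the other remains. *)
Lemma hausdorff_dist_le_setdist A B (r : \bar R) : A !=set0 -> B !=set0 ->
  (forall c, (`|setdist A c - setdist B c|%:E <= r)%E) ->
  (hausdorff_dist A B <= r)%E.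
Proof.
move=> A0 B0 h; apply: hausdorff_dist_le => // a Aa.
  by rewrite (le_trans _ (h a))// [setdist A a]setdist_mem//
      sub0r normrN lee_fin ler_norm.
by rewrite (le_trans _ (h a))// [setdist B a]setdist_mem// subr0 lee_fin ler_norm.
Qed.

Lemma hausdorff_dist_ge0 A B : A !=set0 -> B !=set0 ->
  (0 <= hausdorff_dist A B)%E.
Proof. by move=> A0 B0; apply: le_trans (setdist_dist_le_hausdorff 0 A0 B0). Qed.

Lemma hausdorff_distxx A : A !=set0 -> hausdorff_dist A A = 0%E.
Proof.
move=> A0; apply/eqP; rewrite eq_le hausdorff_dist_ge0// andbT.
by apply: hausdorff_dist_le_setdist => // c; rewrite subrr normr0.
Qed.

Lemma hausdorff_dist_triangle B A C : A !=set0 -> B !=set0 -> C !=set0 ->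
  (hausdorff_dist A C <= hausdorff_dist A B + hausdorff_dist B C)%E.
Proof.
move=> A0 B0 C0; apply: hausdorff_dist_le_setdist => // c.
apply: (@le_trans _ _
    (`|setdist A c - setdist B c|%:E + `|setdist B c - setdist C c|%:E)%E).
  by rewrite -EFinD lee_fin (le_trans _ (ler_normD _ _))// addrA subrK.
by apply: leeD; exact: setdist_dist_le_hausdorff.
Qed.

Lemma eucl_dist_le_hausdorff0 A a : A a ->
  ((eucl_dist a 0%R)%:E <= hausdorff_dist A [set 0%R])%E.
Proof.
by move=> Aa; rewrite -setdist1; apply: setdist_le_hausdorff => //; exists 0.
Qed.

Lemma hausdorff_dist0_le A (r : \bar R) : A !=set0 ->
  (forall a, A a -> ((eucl_dist a 0%R)%:E <= r)%E) ->
  (hausdorff_dist A [set 0%R] <= r)%E.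
Proof.
move=> A0 h; apply: hausdorff_dist_le => // [|a /h|b ->]; [by exists 0| |].
  by rewrite setdist1.
case: A0 => a Aa; apply: le_trans (h _ Aa).
by rewrite lee_fin eucl_distC setdist_le.
Qed.

Lemma hausdorff_dist_le_bounded A B r : A !=set0 -> B !=set0 ->
  (forall a, A a -> eucl_dist a 0 <= r) -> (forall b, B b -> eucl_dist b 0 <= r) ->
  (hausdorff_dist A B <= (r *+ 2)%:E)%E.
Proof.
move=> A0 B0 Ar Br; rewrite mulr2n EFinD.
have le_r C : C !=set0 -> (forall c, C c -> eucl_dist c 0 <= r) ->
    (hausdorff_dist C [set 0%R] <= r%:E)%E.
  by move=> C0 Cr; apply: hausdorff_dist0_le => // c /Cr; rewrite lee_fin.
have n0 : [set 0 : 'rV[R]_m] !=set0 by exists 0.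
apply: (le_trans (hausdorff_dist_triangle A0 n0 B0)).
by rewrite leeD ?[hausdorff_dist [set _] _]hausdorff_distC ?le_r.
Qed.

Lemma eucl_ball_finite_net (r e : R) : 0 < e ->
  exists s : seq 'rV[R]_m, forall x, eucl_dist x 0 <= r ->
    exists2 c, c \in s & eucl_dist x c < e.
Proof.
move=> e0; pose K := [set x : 'rV[R]_m | forall i, `[- r, r]%classic (x ord0 i)].
have /compact_near_coveringP cK : compact K.
  by apply: (@rV_compact _ _ (fun=> `[- r, r]%classic)) => _; exact: segment_compact.
(* [F] is the filter of tails of finite lists ordered by inclusion. The near-covering form of
   compactness then yields one list for the whole cube [K], which contains the ball. *)
pose F : set_system (seq 'rV[R]_m) := 
  [set P | exists s : seq 'rV[R]_m, forall t : seq 'rV[R]_m, {subset s <= t} -> P t].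
have FF : Filter F.
  split; first by exists [::].
  - move=> P Q [s sP] [t tQ]; exists (s ++ t) => u stu.
    by split; [apply: sP|apply: tQ] => x xs; apply: stu; rewrite mem_cat xs ?orbT.
  - by move=> P Q PQ [s sP]; exists s => t /sP /PQ.
have [|s hs] := cK _ F (fun (t : seq 'rV[R]_m) x =>
    exists2 c, c \in t & eucl_dist x c < e) FF.
  move=> x _; exists ([set y | eucl_dist x y < e],
    [set t : seq 'rV[R]_m | x \in t]) => /=.
    split; first by apply/nbhs_eucl_distP; exists e.
    by exists [:: x] => t; apply; rewrite mem_head.
  by move=> [y t] /= [xy xt]; exists x => //; rewrite eucl_distC.
exists s => x xr; apply: (hs s) => // i /=; rewrite in_itv /= -ler_norml.
by apply: le_trans xr; have := le_coord_eucl_dist x 0 i; rewrite mxE subr0.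
Qed.

End euclidean_distance.

(** * Integrals of nested families of sets *)

Section integration.
Context (R : realType).
Local Notation mu := (@lebesgue_measure R).
Local Open Scope ereal_scope.

(** Lebesgue measure is determined by its values on half-open intervals, where translation
    invariance is a computation. *)
Lemma lebesgue_measure_shift (c : R) (A : set R) : measurable A ->
  pushforward mu (shift c : _ -> measurableTypeR R) A = mu A.
Proof.
move=> mA; apply/esym/lebesgue_measure_unique => //=.
  by apply: (measurable_funD (f := id)); [exact: measurable_id|exact: measurable_cst].
move=> _ X [[a b]] _ <-.
rewrite /pushforward.
have -> : (shift c : _ -> measurableTypeR R) @^-1` `]a, b] =
    `](a - c)%R, (b - c)%R]%classic.
  by apply/seteqP; split => x /=; rewrite !in_itv/= ltrBlDr lerBrDr.
rewrite !lebesgue_measure_itv/= !lte_fin ltrD2r.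
by case: ifP => // _; rewrite -!EFinB; congr (_%:E); ring.
Qed.

Lemma ge0_integral_shift (c a b : R) (f : R -> \bar R) :
  measurable_fun setT f -> (forall x, 0 <= f x) ->
  \int[mu]_(x in `[(a + c)%R, (b + c)%R]) f (x - c)%R = \int[mu]_(x in `[a, b]) f x.
Proof.
move=> mf f0.
have -> : `[(a + c)%R, (b + c)%R]%classic =
    (shift (- c)%R : _ -> measurableTypeR R) @^-1` `[a, b].
  by apply/seteqP; split => x /=; rewrite !in_itv/= lerBrDr lerBlDr.
have mshift : measurable_fun setT
    (shift (- c)%R : measurableTypeR R -> measurableTypeR R).
  by apply: (measurable_funD (f := id)); [exact: measurable_id|exact: measurable_cst].
transitivity (\int[pushforward mu
    (shift (- c)%R : _ -> measurableTypeR R)]_(y in `[a, b]) f y).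
  by symmetry; apply: (ge0_integral_pushforward mshift mu) => //;
    exact: measurable_funTS.
by apply: eq_measure_integral => //= A mA AS; exact: lebesgue_measure_shift.
Qed.

Lemma ge0_integral_itv_split (a b c : R) (f : R -> \bar R) :
  measurable_fun setT f -> (forall x, 0 <= f x) -> (a <= b <= c)%R ->
  \int[mu]_(x in `[a, c]) f x =
  \int[mu]_(x in `[a, b]) f x + \int[mu]_(x in `[b, c]) f x.
Proof.
move=> mf f0 /andP[ab bc].
rewrite -(@integral_itv_obnd_cbnd _ b); last exact: measurable_funTS.
have E : `[a, c]%classic = `[a, b] `|` `]b, c].
  by rewrite -itv_bndbnd_setU//= bnd_simp.
rewrite E ge0_integral_setU//; first exact: measurable_funTS.
apply/disj_set2P/seteqP; split => // x /= []; rewrite !in_itv/=.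
by move=> /andP[_ xb] /andP[]; rewrite ltNge xb.
Qed.

Lemma ge0_integral_itv_le_cst (a b r : R) (f : R -> \bar R) :
  measurable_fun setT f -> (forall x, 0 <= f x) -> (a <= b)%R ->
  (forall x, (a < x < b)%R -> f x <= r%:E) ->
  \int[mu]_(x in `[a, b]) f x <= (r * (b - a))%:E.
Proof.
move=> mf f0 ab fr; rewrite integral_itv_bndoo; last exact: measurable_funTS.
apply: (@le_trans _ _ (\int[mu]_(x in `]a, b[) (cst r%:E x))).
  by apply: ge0_le_integral => //; exact: measurable_funTS.
rewrite integral_cst//= lebesgue_measure_itv/= lte_fin.
case: ltP => [_|ba]; first by rewrite -EFinB -EFinM.
by rewrite mule0 lee_fin (_ : a = b) ?subrr ?mulr0//; apply/le_anti; rewrite ab.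
Qed.

Lemma ge0_subset_integral_itv (a b a' b' : R) (f : R -> \bar R) :
  measurable_fun setT f -> (forall x, 0 <= f x) -> (a' <= a)%R -> (b <= b')%R ->
  \int[mu]_(x in `[a, b]) f x <= \int[mu]_(x in `[a', b']) f x.
Proof.
move=> mf f0 aa' bb'; apply: ge0_subset_integral => //; first exact: measurable_funTS.
by move=> x /=; rewrite !in_itv/= => /andP[/(le_trans aa') -> /le_trans ->].
Qed.

(** The point 0 is negligible, and []0, b]] is exhausted by the intervals [[1/(n+1), b]]; monotone
    convergence concludes. *)
Lemma ge0_integral_itv0_le (b : R) (r : \bar R) (f : R -> \bar R) :
  measurable_fun setT f -> (forall x, 0 <= f x) ->
  (forall a, (0 < a)%R -> \int[mu]_(x in `[a, b]) f x <= r) ->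
  \int[mu]_(x in `[0%R, b]) f x <= r.
Proof.
move=> mf f0 fr; rewrite -integral_itv_obnd_cbnd; last exact: measurable_funTS.
pose F (n : nat) : set (measurableTypeR R) := `[(n.+1%:R^-1 : R)%R, b]%classic.
have -> : `]0%R, b]%classic = \bigcup_n F n.
  apply/seteqP; split => x /=; rewrite in_itv/=.
    move=> /andP[x0 xb].
    have [n _ /(_ n (leqnn n)) /= nx] := near_infty_natSinv_lt (PosNum x0).
    by exists n => //; rewrite /F /= in_itv/= (ltW nx).
  move=> [n _]; rewrite /F /= in_itv/= => /andP[nx ->].
  by rewrite (lt_le_trans _ nx)// invr_gt0.
have cF := @ge0_nondecreasing_set_cvg_integral _ _ R F f mu.
apply: cvge_le (cF _ _ _ _).
- by apply: nearW => n; apply: fr; rewrite invr_gt0.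
- apply/nondecreasing_seqP => n; apply/subsetPset => x.
  rewrite /F /= !in_itv/= => /andP[nx ->]; rewrite andbT (le_trans _ nx)//.
  by rewrite lef_pV2 ?posrE// ler_nat.
- by move=> n; exact: measurable_itv.
- by move=> n; exact: measurable_funTS.
- by [].
Qed.

End integration.

Section nested_families.
Context (R : realType) (m : nat) (p : R) (p0 : 0 < p).
Local Notation mu := (@lebesgue_measure R).
Implicit Types (A B C : R -> set 'rV[R]_m).

(** Levels range over all reals, so that a shift by [h] needs no side condition. *)
Definition nested A :=
  (forall al, A al !=set0) /\ (forall al be, al <= be -> A be `<=` A al).

Lemma nested_cst (S : set 'rV[R]_m) : S !=set0 -> nested (fun=> S).
Proof. by move=> S0; split=> // al be _ x. Qed.

Lemma nested_shift A h : nested A -> nested (fun al => A (al + h)).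
Proof.
by move=> [A0 dA]; split=> // al be albe; apply: dA; rewrite lerD2r.
Qed.

(** An enumeration of the rational points; numbers that code none of them give 0. *)
Let rat_point (n : nat) : 'rV[R]_m :=
  if @unpickle 'rV[rat]_m n is Some q then map_mx ratr q else 0.

Let rat_point_dense (x : 'rV[R]_m) (e : R) : 0 < e ->
  exists n, eucl_dist x (rat_point n) < e.
Proof.
move=> e0; have e'0 : 0 < e / m.+1%:R by rewrite divr_gt0.
have q_ (i : 'I_m) : {q : rat | `|x 0 i - ratr q| < e / m.+1%:R}.
  apply: cid; have [|q] := @rat_in_itvoo R (x 0 i - e / m.+1%:R) (x 0 i).
    by rewrite ltrBlDr ltrDl.
  rewrite in_itv/= => /andP[xq qx]; exists q.
  by rewrite gtr0_norm ?subr_gt0// ltrBlDr -ltrBlDl.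
exists (pickle (\row_i (sval (q_ i)))); rewrite /rat_point pickleK.
apply: (le_lt_trans (eucl_dist_le_sum _ _)).
apply: (@le_lt_trans _ _ (\sum_(i < m) (e / m.+1%:R))).
  by apply: ler_sum => i _; rewrite !mxE; apply/ltW; exact: (svalP (q_ i)).
rewrite sumr_const card_ord -[ltLHS]mulr_natr mulrAC ltr_pdivrMr//.
by rewrite ltr_pM2l// ltr_nat.
Qed.

(** Distance functions are 1-Lipschitz, so their difference has the same supremum over the countably
    many rational points. At each of these points it is a difference of monotone functions of the
    level, hence measurable. *)
Lemma measurable_hausdorff_dist A B : nested A -> nested B ->
  measurable_fun setT (fun al => hausdorff_dist (A al) (B al)).
Proof.
move=> [A0 dA] [B0 dB].
pose f n (al : R) : \bar R :=
  `|setdist (A al) (rat_point n) - setdist (B al) (rat_point n)|%:E.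
suff -> : (fun al => hausdorff_dist (A al) (B al)) = (fun al => esups (f ^~ al) 0).
  apply: measurable_fun_esups => n; apply/measurable_EFinP.
  apply: measurableT_comp => //.
  by apply: measurable_funB; apply: nondecreasing_measurable => // al be albe;
    apply: setdist_subset => //; [exact: dA|exact: dB].
apply/funext => al; apply/eqP; rewrite eq_le; apply/andP; split; last first.
  apply: ge_ereal_sup => _ [n _ <-]; exact: setdist_dist_le_hausdorff.
apply: hausdorff_dist_le_setdist => // c; apply/lee_addgt0Pr => e e0.
have [n cn] : exists n, eucl_dist c (rat_point n) < e / 2.
  by apply: rat_point_dense; rewrite divr_gt0.
apply: (@le_trans _ _ (f n al + e%:E)%E); last first.
  by rewrite leeD2r// ereal_sup_ubound//; exists n.
rewrite /f -EFinD lee_fin.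
have tri S : S !=set0 -> `|setdist S c - setdist S (rat_point n)| <= e / 2.
  move=> S0; rewrite ler_norml; apply/andP; split.
    rewrite lerNl opprB lerBlDr (le_trans (setdist_triangle _ c S0))//.
    by rewrite lerD2r eucl_distC ltW.
  by rewrite lerBlDr (le_trans (setdist_triangle _ (rat_point n) S0))// lerD2r ltW.
have := tri _ (A0 al); have := tri _ (B0 al).
set a := setdist _ _; set b := setdist _ _.
set a' := setdist _ _; set b' := setdist _ _.
rewrite !ler_norml => /andP[h1 h2] /andP[h3 h4].
case: (ler0P (a' - a)) => h5; case: (ler0P (b' - b)) => h6; lra.
Qed.

(** For cuts this is the [p]-th power of [dp], restricted to the levels in [[a, b]]. Without the
    root it is additive in the interval. *)
Definition hint (a b : R) A B : \bar R :=
  (\int[mu]_(al in `[a, b]) (hausdorff_dist (A al) (B al) `^ p))%E.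

Lemma measurable_hausdorff_dist_poweR A B : nested A -> nested B ->
  measurable_fun setT (fun al => hausdorff_dist (A al) (B al) `^ p)%E.
Proof.
move=> nA nB; apply: (measurableT_comp (f := fun x => poweR x p)).
  exact: measurable_poweR.
exact: measurable_hausdorff_dist.
Qed.

Let integrand_ge0 A B al : (0 <= hausdorff_dist (A al) (B al) `^ p)%E.
Proof. exact: poweR_ge0. Qed.

Lemma hint_ge0 a b A B : (0 <= hint a b A B)%E.
Proof. by apply: integral_ge0 => al _; exact: poweR_ge0. Qed.

Lemma hintC a b A B : hint a b A B = hint a b B A.
Proof. by apply: eq_integral => al _; rewrite hausdorff_distC. Qed.

Lemma hint_eq a b A B A' B' : (forall al, a <= al <= b -> A al = A' al) ->
  (forall al, a <= al <= b -> B al = B' al) -> hint a b A B = hint a b A' B'.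
Proof.
move=> AA' BB'; apply: eq_integral => al; rewrite inE /= in_itv /= => h.
by rewrite AA'// BB'.
Qed.

Lemma hint_subset a b a' b' A B : nested A -> nested B -> a' <= a -> b <= b' ->
  (hint a b A B <= hint a' b' A B)%E.
Proof.
move=> nA nB; apply: ge0_subset_integral_itv => //.
exact: measurable_hausdorff_dist_poweR.
Qed.

Lemma hint_split a b c A B : nested A -> nested B -> a <= b <= c ->
  hint a c A B = (hint a b A B + hint b c A B)%E.
Proof.
move=> nA nB; apply: ge0_integral_itv_split => //.
exact: measurable_hausdorff_dist_poweR.
Qed.

Lemma hint_shift h a b A B : nested A -> nested B ->
  hint (a + h) (b + h) (fun al => A (al - h)) (fun al => B (al - h)) = hint a b A B.
Proof.
move=> nA nB; pose f al := (hausdorff_dist (A al) (B al) `^ p)%E.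
have mf : measurable_fun setT f by exact: measurable_hausdorff_dist_poweR.
by apply: (ge0_integral_shift h a b mf) => al; exact: poweR_ge0.
Qed.

Lemma hint_le_cst a b (r : R) A B : nested A -> nested B -> a <= b ->
  (forall al, a < al < b -> (hausdorff_dist (A al) (B al) `^ p <= r%:E)%E) ->
  (hint a b A B <= (r * (b - a))%:E)%E.
Proof.
move=> nA nB; apply: ge0_integral_itv_le_cst => //.
exact: measurable_hausdorff_dist_poweR.
Qed.

Lemma hint0_le b (r : \bar R) A B : nested A -> nested B ->
  (forall a, 0 < a -> (hint a b A B <= r)%E) -> (hint 0 b A B <= r)%E.
Proof.
move=> nA nB; apply: ge0_integral_itv0_le => //.
exact: measurable_hausdorff_dist_poweR.
Qed.

(** Pointwise, [(x + y)^p] is at most [(2 max(x, y))^p], hence at most [2^p (x^p + y^p)]. *)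
Lemma hint_triangle B a b A C : nested A -> nested B -> nested C ->
  (hint a b A C <= (2 `^ p)%:E * (hint a b A B + hint a b B C))%E.
Proof.
move=> nA nB nC; have mH A' B' : nested A' -> nested B' ->
    measurable_fun `[a, b] (fun al => hausdorff_dist (A' al) (B' al) `^ p)%E.
  by move=> ? ?; apply: measurable_funTS; exact: measurable_hausdorff_dist_poweR.
rewrite /hint -ge0_integralD//; [|exact: mH|exact: mH].
rewrite -ge0_integralZl//; last 2 first.
- by apply: emeasurable_funD; exact: mH.
- by move=> al _; rewrite adde_ge0.
apply: ge0_le_integral => //.
- exact: mH.
- apply: measurable_funeM; apply: emeasurable_funD; exact: mH.
move=> al _; move: nA nB nC => [A0 _] [B0 _] [C0 _].
have := hausdorff_dist_triangle (A0 al) (B0 al) (C0 al).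
have := hausdorff_dist_ge0 (A0 al) (C0 al).
have := hausdorff_dist_ge0 (A0 al) (B0 al).
have := hausdorff_dist_ge0 (B0 al) (C0 al).
move: (hausdorff_dist (A al) (C al)) (hausdorff_dist (A al) (B al))
  (hausdorff_dist (B al) (C al)) => z x y y0 x0 z0 zxy.
have mono u v : (0 <= u -> u <= v -> u `^ p <= v `^ p)%E.
  move=> u0 uv; apply: gt0_ler_poweR; rewrite ?in_itv/= ?leey ?andbT ?(ltW p0)//.
  exact: le_trans uv.
have z2 : (z <= 2%:E * maxe x y)%E.
  apply: (le_trans zxy); rewrite mule_natl mule2n.
  by rewrite leeD// le_max lexx ?orbT.
apply: (le_trans (mono _ _ z0 z2)); rewrite poweRM ?lee_fin//; last first.
  by rewrite le_max x0.
rewrite poweR_EFin lee_wpmul2l// ?lee_fin ?powR_ge0//.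
by case: (leP x y) => _; rewrite ?leeDr ?leeDl ?poweR_ge0.
Qed.

(** If every [[0, d]] carried more than [e], every [[c, 1]] would carry at most the total minus [e];
    by [hint0_le] so would the total, which is finite. *)
Lemma hint_near0 A B (e : R) : nested A -> nested B -> (hint 0 1 A B < +oo)%E ->
  0 < e -> exists2 d, 0 < d < 1 & (hint 0 d A B <= e%:E)%E.
Proof.
move=> nA nB fin e0; apply: contrapT => nd.
suff : (hint 0 1 A B <= hint 0 1 A B - e%:E)%E.
  have fin' : hint 0 1 A B \is a fin_num by rewrite ge0_fin_numE// hint_ge0.
  by rewrite -(fineK fin') -EFinB lee_fin leNgt gtrBl e0.
apply: hint0_le => // a a0; pose c := Num.min a 2^-1.
have c01 : 0 < c < 1 by rewrite lt_min a0 gt_min invr_gt0 ltr0n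
    invf_lt1 ?ltr0n// ltr1n orbT.
have : (hint c 1 A B <= hint 0 1 A B - e%:E)%E.
  rewrite leeBrDr// [X in (_ <= X)%E](hint_split (b := c) nA nB); last first.
    by case/andP: c01 => /ltW -> /ltW ->.
  rewrite addeC leeD2r//; apply/ltW; rewrite ltNge; apply/negP => h.
  by apply: nd; exists c.
by apply: le_trans; apply: hint_subset => //; rewrite ge_min lexx.
Qed.

End nested_families.

(** * From convergence of distance functions to convergence of integrals *)

Section convergence.
Context (R : realType) (m : nat).

(** A point of one set is within [e] of some net point, and moving there and back costs at most [e]
    in each of the two 1-Lipschitz distance functions. *)
Lemma hausdorff_dist_le_net (A B : set 'rV[R]_m) (r e q : R) (s : seq 'rV[R]_m) :
  A !=set0 -> B !=set0 ->
  (forall x, A x -> eucl_dist x 0 <= r) -> (forall x, B x -> eucl_dist x 0 <= r) ->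
  (forall x, eucl_dist x 0 <= r -> exists2 c, c \in s & eucl_dist x c < e) ->
  (forall c, c \in s -> `|setdist A c - setdist B c| <= q) ->
  (hausdorff_dist A B <= (q + e *+ 2)%:E)%E.
Proof.
move=> A0 B0 Ar Br net Aq; have bound S T : S !=set0 -> T !=set0 ->
    (forall x, S x -> eucl_dist x 0 <= r) ->
    (forall c, c \in s -> setdist T c <= setdist S c + q) ->
    forall x, S x -> ((setdist T x)%:E <= (q + e *+ 2)%:E)%E.
  move=> S0 T0 Sr STq x Sx; rewrite lee_fin; have [c cs xc] := net _ (Sr _ Sx).
  have := setdist_triangle x c T0; have := STq _ cs; have := setdist_le c Sx.
  by rewrite eucl_distC mulr2n; lra.
apply: hausdorff_dist_le => //; apply: bound => // c /Aq;
  by rewrite ler_norml => /andP[h1 h2]; lra.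
Qed.

Lemma near_forall_in (T : Type) (F : set_system T) (FF : Filter F) (I : eqType)
    (s : seq I) (Q : I -> T -> Prop) :
  (forall i, i \in s -> \forall t \near F, Q i t) ->
  \forall t \near F, forall i, i \in s -> Q i t.
Proof.
elim: s => [_|i s ih h]; first by apply: filterE.
have := h i (mem_head _ _); have := ih (fun j js => h j (@mem_behead _ (i :: s) j js)).
apply: filterS2 => t Qs Qi j; rewrite inE => /predU1P[->//|]; exact: Qs.
Qed.

(* On each cell of a uniform grid the integrand is controlled by the oscillation
   of the limits [l c], [c] ranging over a finite net; these oscillations
   telescope, so their contribution vanishes with the mesh. *)
Lemma hint_cvg0 (p : R) (T : Type) (F : set_system T) (FF : Filter F)
    (A : T -> R -> set 'rV[R]_m) (B : R -> set 'rV[R]_m)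
    (l : 'rV[R]_m -> R -> R) (a r e : R) : 1 <= p -> 0 <= a < 1 ->
  (forall t, nested (A t)) -> nested B ->
  (\forall t \near F, forall x, A t a x -> eucl_dist x 0 <= r) ->
  (forall x, B a x -> eucl_dist x 0 <= r) ->
  (forall c al, a <= al <= 1 -> setdist (A t al) c @[t --> F] --> l c al) ->
  (forall c be al, a <= be -> be < al <= 1 -> l c be <= setdist (B al) c) ->
  (forall c al ga, a <= al < ga -> ga <= 1 -> setdist (B al) c <= l c ga) ->
  0 < e -> \forall t \near F, (hint p a 1 (A t) B <= e%:E)%E.
Proof.
move=> p1 /andP[a0 a1] nA nB FAr Br Al lB Bl e0.
have p0 : 0 < p by exact: lt_le_trans p1.
have [[x0 Bx0] r0] : B a !=set0 /\ 0 <= r.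
  case: nB => /(_ a)[x Bx] _; split; first by exists x.
  exact: le_trans (eucl_dist_ge0 _ _) (Br _ Bx).
(* In [x^p = x^(p-1) * x], with [x] the Hausdorff distance, the first factor is at most [K], since
   both sets lie in the ball of radius [r]. *)
pose K := (r *+ 2) `^ (p - 1).
have K0 : 0 <= K by exact: powR_ge0.
(* Makes [K * (3 * eta)] at most [e / 2]. Of the three [eta], one pays for the convergence at grid
   levels and two for the net. *)
pose eta := e / 6 / (K + 1).
have K10 : 0 < K + 1 by rewrite ltr_wpDl.
have eta0 : 0 < eta by rewrite !divr_gt0.
have [s net] := @eucl_ball_finite_net R m r eta eta0.
(* As each [l c] is monotone, the increment of [W] over a cell dominates that of every single
   [l c]. *)
pose W al := \sum_(c <- s) l c al.
have l_mono c al ga : a <= al -> al < ga <= 1 -> l c al <= l c ga.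
  move=> aal /andP[alga ga1]; apply: (@le_trans _ _ (setdist (B ((al + ga) / 2)) c)).
    by apply: lB => //; apply/andP; split; lra.
  by apply: Bl => //; apply/andP; split; lra.
(* Enough cells to make [K * (W 1 - W a)] at most [n * e / 2]. *)
pose n := (Num.truncn (2 * (K * (W 1 - W a)) / e)).+1.
have n0 : 0 < n%:R :> R by rewrite ltr0n.
pose h := (1 - a) / n%:R.
have h0 : 0 < h by rewrite divr_gt0// subr_gt0.
have nh : n%:R * h = 1 - a by rewrite mulrC divfK// gt_eqF.
have h1 : n%:R * (K * (3 * eta)) + K * (W 1 - W a) <= n%:R * e.
  have : K * (3 * eta) <= e / 2.
    rewrite /eta -subr_ge0.
    have -> : e / 2 - K * (3 * (e / 6 / (K + 1))) = e / 2 / (K + 1).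
      by field; rewrite gt_eqF.
    by rewrite !divr_ge0// ltW.
  have : 2 * (K * (W 1 - W a)) / e < n%:R by exact: truncnS_gt.
  by rewrite ltr_pdivrMr//; nra.
have W0 : 0 <= W 1 - W a.
  rewrite /W -sumrB; apply: sumr_ge0 => c _.
  by rewrite subr_ge0 l_mono// a1 lexx.
pose g (k : nat) := a + k%:R * h.
have g_ge k : a <= g k by rewrite lerDl mulr_ge0// ltW.
have g_lt k : g k < g k.+1 by rewrite /g ltrD2l ltr_pM2r// ltr_nat.
have g_le k : (k <= n)%N -> g k <= 1.
  move=> kn; rewrite /g -lerBrDl -nh ler_pM2r// ler_nat//.
have FAl : \forall t \near F, forall k, k \in iota 0 n.+1 ->
    forall c, c \in s -> `|setdist (A t (g k)) c - l c (g k)| < eta.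
  apply: near_forall_in => k; rewrite mem_iota add0n /= => kn.
  apply: near_forall_in => c _.
  have /Al/cvgrPdist_lt/(_ _ eta0) : a <= g k <= 1 by rewrite g_ge g_le.
  by move=> /(_ c); apply: filterS => t; rewrite distrC.
apply: filterS2 FAl FAr => t Atl Atr.
have cell k : (k < n)%N -> (hint p (g k) (g k.+1) (A t) B <=
    (K * (W (g k.+1) - W (g k) + 3 * eta) * h)%:E)%E.
  move=> kn; have -> : h = g k.+1 - g k by rewrite /g -natr1; ring.
  apply: hint_le_cst => //; first exact/ltW.
  move=> al /andP[gal alg]; have [A0 dA] := nA t; have [B0 dB] := nB.
  have aal : a <= al by exact: le_trans (g_ge k) (ltW gal).
  have al1 : al <= 1 by exact: le_trans (ltW alg) (g_le _ kn).
  have hnet : (hausdorff_dist (A t al) (B al) <=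
      (W (g k.+1) - W (g k) + 3 * eta)%:E)%E.
    apply: (@le_trans _ _ ((W (g k.+1) - W (g k) + eta) + eta *+ 2)%:E).
      apply: (hausdorff_dist_le_net (A0 al) (B0 al) _ _ net).
      - by move=> x /(dA _ _ aal); exact: Atr.
      (* At a net point, both distance functions at level [al] lie between the values of [l] at the
         ends of the cell, up to [eta]. *)
      - by move=> x /(dB _ _ aal); exact: Br.
      move=> c cs; apply: (@le_trans _ _ (l c (g k.+1) - l c (g k) + eta)).
        have := Atl k _ c cs; rewrite mem_iota add0n /= ltnS => /(_ (ltnW kn)).
        have := Atl k.+1 _ c cs; rewrite mem_iota add0n /= ltnS => /(_ kn).
        have := setdist_subset c (A0 al) (dA _ _ (ltW gal)).
        have := setdist_subset c (A0 (g k.+1)) (dA _ _ (ltW alg)).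
        have := lB c (g k) al (g_ge _); rewrite gal al1 => /(_ isT).
        have := Bl c al (g k.+1); rewrite aal alg => /(_ isT (g_le _ kn)).
        rewrite !ltr_norml ler_norml => ? ? ? ? /andP[? ?] /andP[? ?].
        by apply/andP; split; lra.
      rewrite lerD2r /W -sumrB (big_rem c)//= lerDl sumr_ge0// => d _.
      by rewrite subr_ge0 l_mono// g_lt g_le.
    by rewrite lee_fin mulr2n; lra.
  have hr : (hausdorff_dist (A t al) (B al) <= (r *+ 2)%:E)%E.
    apply: hausdorff_dist_le_bounded => // x.
    - by move=> /(dA _ _ aal); exact: Atr.
    - by move=> /(dB _ _ aal); exact: Br.
  have := hausdorff_dist_ge0 (A0 al) (B0 al).
  case: (hausdorff_dist _ _) hnet hr => [x| |]//; rewrite !lee_fin => hnet hr x0'.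
  have -> : x `^ p = x `^ (p - 1) * x.
    have [->|xn0] := eqVneq x 0; first by rewrite mulr0 powR0// gt_eqF.
    rewrite -[X in _ * X](powRr1 x0') -powRD ?subrK//.
    by apply/implyP.
  apply: ler_pM => //; first exact: powR_ge0.
  by apply: ge0_ler_powR; rewrite ?nnegrE ?subr_ge0// ?mulrn_wge0.
(* The error [3 * eta] accrues in each cell, whereas the increments of [W] telescope. *)
have prefix k : (k <= n)%N -> (hint p a (g k) (A t) B <=
    (h * (k%:R * (K * (3 * eta)) + K * (W (g k) - W a)))%:E)%E.
  elim: k => [_|k ih kn].
    apply: (le_trans (hint_le_cst (r := 0) (nA t) nB _ _)) => //.
    - by move=> al; rewrite /g mul0r addr0 => /andP[/lt_trans/[apply]]; rewrite ltxx.
    - by rewrite /g !mul0r addr0 subrr mulr0 addr0 mulr0.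
  rewrite (hint_split p (b := g k) (nA t) nB); last by rewrite g_ge (ltW (g_lt _)).
  apply: (le_trans (leeD (ih (ltnW kn)) (cell _ kn))).
  by rewrite -EFinD lee_fin -natr1; lra.
have gn1 : g n = 1 by rewrite -[RHS](subrK a) -nh addrC.
have := prefix n (leqnn n); rewrite gn1 => /le_trans; apply.
rewrite lee_fin -(ler_pM2l n0) [leLHS]mulrA nh (le_trans _ h1)//.
rewrite -[leRHS]mul1r ler_wpM2r ?gerBl//.
have := mulr_ge0 K0 W0; have := mulr_ge0 (ltW n0) (mulr_ge0 K0 (ltW eta0)); lra.
Qed.

End convergence.

(** * Bounds on the integrals and pointwise bounds *)

Section nested_estimates.
Context (R : realType) (m : nat) (p : R) (p0 : 0 < p).
Implicit Types (A B C : R -> set 'rV[R]_m).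

Lemma powRKV (x : R) : 0 <= x -> (x `^ p^-1) `^ p = x.
Proof. by move=> x0; rewrite -powRrM mulVf ?gt_eqF// powRr1. Qed.

Lemma ler_powR_iff (x y : R) : 0 <= x -> 0 <= y -> (x `^ p <= y `^ p) = (x <= y).
Proof.
move=> x0 y0; apply/idP/idP => [|xy]; last first.
  by apply: ge0_ler_powR; rewrite ?nnegrE// ltW.
by apply: contraTT; rewrite -!ltNge => yx; apply: gt0_ltr_powR.
Qed.

(** Removes the outer root, turning bounds on [dp] into bounds on [hint]. *)
Lemma poweRV_le (x : \bar R) (e : R) : (0 <= x)%E -> 0 <= e ->
  (x `^ p^-1 <= e%:E)%E = (x <= (e `^ p)%:E)%E.
Proof.
case: x => [x| |]//= x0 e0; last first.
  by rewrite invr_eq0 gt_eqF// !leye_eq.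
rewrite lee_fin in x0.
by rewrite !lee_fin -ler_powR_iff ?powR_ge0// powRKV.
Qed.

Lemma hint_triangle_le B a b A C (x y : R) : nested A -> nested B -> nested C ->
  (hint p a b A B <= x%:E)%E -> (hint p a b B C <= y%:E)%E ->
  (hint p a b A C <= (2 `^ p * (x + y))%:E)%E.
Proof.
move=> nA nB nC hx hy; apply: (le_trans (hint_triangle p0 a b nA nB nC)).
by rewrite EFinM lee_wpmul2l ?lee_fin ?powR_ge0// EFinD leeD.
Qed.

Lemma hint_refl a b A : nested A -> hint p a b A A = 0%E.
Proof.
move=> [A0 _]; apply: integral0_eq => al _.
by rewrite hausdorff_distxx// poweR0r// gt_eqF.
Qed.

Lemma hint_ge_cst a b (c : R) A B : nested A -> nested B -> a <= b -> 0 <= c ->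
  (forall al, a <= al <= b -> (c%:E <= hausdorff_dist (A al) (B al))%E) ->
  ((c `^ p * (b - a))%:E <= hint p a b A B)%E.
Proof.
move=> nA nB ab c0 h.
apply: (@le_trans _ _ (\int[lebesgue_measure]_(x in `[a, b]) (cst (c `^ p)%:E x))%E).
  rewrite integral_cst//= lebesgue_measure_itv/= lte_fin.
  case: ltP => [_|ba]; first by rewrite -EFinB -EFinM.
  by rewrite mule0 lee_fin (_ : a = b) ?subrr ?mulr0//; apply/le_anti; rewrite ab.
apply: ge0_le_integral => //.
- by move=> al _; rewrite lee_fin powR_ge0.
- by apply: measurable_funTS; exact: measurable_hausdorff_dist_poweR.
move=> al; rewrite /= in_itv/= => /h cH; rewrite -poweR_EFin.
have c0' : (0 <= c%:E)%E by rewrite lee_fin.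
by apply: gt0_ler_poweR; rewrite ?in_itv/= ?leey ?andbT ?(ltW p0)// (le_trans c0').
Qed.

(** A Chebyshev bound: [x] lies in all the larger sets [A be], [be <= al], so the integrand is at
    least [eucl_dist x 0 ^ p] on an interval of length [al]. *)
Lemma nested_bounded A (M al : R) : nested A ->
  (hint p 0 1 A (fun=> [set 0%R]) <= M%:E)%E -> 0 < al <= 1 ->
  forall x, A al x -> eucl_dist x 0 <= (M / al) `^ p^-1.
Proof.
move=> nA AM /andP[al0 al1] x Ax; have n0 : nested (fun=> [set 0 : 'rV[R]_m]).
  by apply: nested_cst; exists 0.
have h : ((eucl_dist x 0 `^ p * (al - 0))%:E <= M%:E)%E.
  apply: le_trans AM; apply: le_trans (hint_subset p nA n0 (lexx 0) al1).
  apply: hint_ge_cst => //; [exact: ltW|exact: eucl_dist_ge0|].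
  move=> be /andP[_ beal]; apply: eucl_dist_le_hausdorff0.
  by have [_ dA] := nA; exact: dA Ax.
have M0 : 0 <= M / al.
  rewrite divr_ge0// ?(ltW al0)//; move: h; rewrite lee_fin; apply: le_trans.
  by rewrite subr0 mulr_ge0 ?powR_ge0// ltW.
rewrite -ler_powR_iff ?eucl_dist_ge0 ?powR_ge0// powRKV//.
by rewrite ler_pdivlMr//; move: h; rewrite subr0 lee_fin.
Qed.

End nested_estimates.

(** * Left continuity in mean of a single nested family *)

Section shifts.
Context (R : realType) (m : nat) (p : R) (p1 : 1 <= p).
Implicit Types (A : R -> set 'rV[R]_m).

Let p0 : 0 < p. Proof. exact: lt_le_trans p1. Qed.

Local Notation zero := (fun=> [set (0 : 'rV[R]_m)]).

Lemma nested0 : nested (fun _ : R => [set (0 : 'rV[R]_m)]).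
Proof. by apply: nested_cst; exists 0. Qed.

(** The distance to [c] is nondecreasing in the level, so its left limit is a supremum. *)
Let near_left A (c : 'rV[R]_m) (al : R) : nested A ->
  setdist (A (al - h)) c @[h --> 0^'+] -->
  sup [set setdist (A be) c | be in [set be | be < al]].
Proof.
move=> [A0 dA]; set S := [set _ | _ in _].
have hS : has_sup S.
  split; first by exists (setdist (A (al - 1)) c), (al - 1) => //=; rewrite gtrBl.
  exists (setdist (A al) c) => _ [be /= beal <-].
  by apply: setdist_subset => //; apply/dA/ltW.
apply/cvgrPdist_lt => e e0; have [_ [be /= beal <-] supS] := sup_adherent e0 hS.
have d0 : 0 < al - be by rewrite subr_gt0.
near=> h.
have hbe : be < al - h by rewrite ltrBrDr -ltrBrDl; near: h; exact: nbhs_right_lt.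
have h0 : 0 < h by near: h; exact: nbhs_right_gt.
have : setdist (A (al - h)) c <= sup S.
  by apply: ub_le_sup; [case: hS|exists (al - h) => //=; rewrite gtrBl].
have := setdist_subset c (A0 (al - h)) (dA _ _ (ltW hbe)).
by rewrite ltr_norml => ? ?; apply/andP; split; lra.
Unshelve. all: by end_near. Qed.

(** Split at a small level [dl]. Below it, the family and its shift are both close to the origin in
    mean; above it, [hint_cvg0] applies with the left limits as [l]. *)
Lemma hint_shift_cvg0 A (e : R) : nested A ->
  (hint p 0 1 A zero < +oo)%E -> 0 < e ->
  exists2 d, 0 < d & forall h, 0 <= h < d ->
    (hint p h 1 A (fun al => A (al - h)%R) <= e%:E)%E.
Proof.
move=> nA fin e0; have n0 := nested0; have [A0 dA] := nA.
have K0 : 0 < 2 `^ p :> R by rewrite powR_gt0.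
pose e1 := e / 4 / 2 `^ p; have e10 : 0 < e1 by rewrite !divr_gt0.
have [dl /andP[dl0 dl1] Adl] := hint_near0 nA n0 fin e10.
have Abnd : (hint p 0 1 A zero <= (fine (hint p 0 1 A zero))%:E)%E.
  by rewrite fineK// ge0_fin_numE// hint_ge0.
(* For [h < dl / 2] the shifted levels stay above [dl / 2], where the sets are bounded. *)
have dl2 : 0 < dl / 2 <= 1 by apply/andP; split; lra.
have bnd := nested_bounded p0 nA Abnd dl2.
have e20 : 0 < e / 2 by rewrite divr_gt0.
have near_dl : \forall h \near 0^'+,
    (hint p dl 1 (fun al => A (al - h)%R) A <= (e / 2)%:E)%E.
  apply: (@hint_cvg0 _ _ p _ _ _ (fun h al => A (al - h)) A
    (fun c al => sup [set setdist (A be) c | be in [set be | be < al]])) => //.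
  - by rewrite (ltW dl0).
  - by move=> h; exact: (nested_shift (- h)).
  - near=> h => x Ax; apply: bnd; apply: dA Ax.
    rewrite lerBrDr -lerBrDl; apply/ltW; near: h; apply: nbhs_right_lt; lra.
  - by move=> x Ax; apply: bnd; apply: dA Ax; lra.
  - by move=> c al _; exact: near_left.
  - move=> c be al _ /andP[beal _]; apply: ge_sup.
      by exists (setdist (A (be - 1)) c), (be - 1) => //=; rewrite gtrBl.
    by move=> _ [ga /= gabe <-]; apply: setdist_subset => //;
      apply/dA/ltW/(lt_trans gabe).
  - move=> c al ga /andP[_ alga] _; apply: ub_le_sup; last by exists al.
    exists (setdist (A ga) c) => _ [be /= bega <-].
    by apply: setdist_subset => //; apply/dA/ltW.
have [d /= d0 hd] := near_dl.
exists (Num.min d dl); first by rewrite lt_min d0.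
(* The case [h = 0] is separate, as [0^'+] contains only information on positive [h]. *)
move=> h /andP[]; rewrite le_eqVlt lt_min => /predU1P[<- _|h0 /andP[hltd hdl]].
  rewrite (hint_eq p (A' := A) (B' := A))// => [|al _]; last by rewrite subr0.
  by rewrite hint_refl// lee_fin ltW.
have nAh : nested (fun al => A (al - h)) by exact: (nested_shift (- h)).
rewrite (hint_split p (b := dl) nA nAh); last by rewrite !ltW.
have -> : e = 2 `^ p * (e1 + e1) + e / 2.
  by rewrite /e1; field; rewrite gt_eqF.
rewrite EFinD leeD//; last first.
  by rewrite hintC; apply: hd => //=; rewrite sub0r normrN gtr0_norm.
apply: (hint_triangle_le p0 nA n0 nAh).
  by apply: le_trans Adl; apply: hint_subset => //; exact: ltW.
have := hint_shift p h 0 (dl - h) n0 nA; rewrite add0r subrK => ->.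
by rewrite hintC; apply: le_trans Adl; apply: hint_subset => //; rewrite gerBl ltW.
Unshelve. all: by end_near. Qed.

End shifts.

(** * Cuts of fuzzy sets and the topology of d_p *)

Section cuts.
Context (R : realType) (m : nat) (p : R) (p1 : 1 <= p).
Implicit Types (u v w : fuzzy_set R m).

Let p0 : 0 < p. Proof. exact: lt_le_trans p1. Qed.

Local Notation zero := (fun=> [set (0 : 'rV[R]_m)]).

(* Levels above 1 are truncated so that all cuts of a normal set are nonempty. *)
Definition cut u (al : R) := alpha_cut u (Num.min al 1).

Lemma cutE u al : 0 < al <= 1 -> cut u al = [set x | al <= u x].
Proof. by move=> /andP[al0 al1]; rewrite /cut /alpha_cut min_l// al0. Qed.

Lemma cut_le1 u al : al <= 1 -> cut u al = alpha_cut u al.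
Proof. by move=> al1; rewrite /cut min_l. Qed.

Lemma nested_cut u : normal_fuzzy u -> nested (cut u).
Proof.
move=> [x0 ux0]; split=> [al|al be albe x].
  exists x0; rewrite /cut /alpha_cut; case: ifPn => _ /=.
    by rewrite ux0 ge_min lexx orbT.
  by apply: subset_closure; rewrite /= ux0.
have : Num.min al 1 <= Num.min be 1.
  by rewrite le_min !ge_min albe lexx orbT.
rewrite /cut /alpha_cut; move: (Num.min al 1) (Num.min be 1) => {al be albe} al be albe.
case: ltP => [be0|be0]; case: ltP => [al0|al0] //=.
- exact: le_trans.
- by move=> beux; apply: subset_closure; exact: lt_le_trans beux.
- by have := lt_le_trans al0 (le_trans albe be0); rewrite ltxx.
Qed.

Lemma cut_hat0 al : al <= 1 -> cut (hat0 R m) al = [set 0].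
Proof.
move=> al1; rewrite cut_le1// /alpha_cut.
have hat0E (x : 'rV[R]_m) : \1_[set 0] x = (x == 0)%:R :> R.
  by rewrite indicE; congr (nat_of_bool _)%:R; rewrite in_set1.
case: ifPn => al0.
  apply/seteqP; split=> x /=; rewrite !hat0E; last by move=> ->; rewrite eqxx.
  by case: eqVneq => // _ /(lt_le_trans al0); rewrite ltxx.
have -> : [set x | 0 < hat0 R m x] = [set 0].
  apply/seteqP; split=> x /=; rewrite !hat0E; last by move=> ->; rewrite eqxx.
  by case: eqVneq => // _; rewrite ltxx.
apply/seteqP; split=> [x clx|x ->]; last exact: subset_closure.
apply: contrapT => /eqP x0; have : nbhs x [set y | eucl_dist x y < eucl_dist x 0].
  apply/nbhs_eucl_distP; exists (eucl_dist x 0) => //.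
  rewrite lt_neqAle eucl_dist_ge0 andbT eq_sym; apply: contra x0 => /eqP h.
  apply/eqP/rowP => i; rewrite mxE; apply/eqP.
  have := le_coord_eucl_dist x 0 i; rewrite h mxE subr0 => h'.
  by rewrite -normr_eq0 eq_le h' normr_ge0.
by move=> /clx[y [-> /=]]; rewrite ltxx.
Qed.

Lemma dpE u v : dp p u v = (hint p 0 1 (cut u) (cut v) `^ p^-1)%E.
Proof.
rewrite /dp /Lp_from; congr (_ `^ _)%E; apply: eq_integral => al.
by rewrite inE /= in_itv /= => /andP[_ al1]; rewrite !cut_le1.
Qed.

Lemma dp_le u v (e : R) : 0 <= e ->
  (dp p u v <= e%:E)%E = (hint p 0 1 (cut u) (cut v) <= (e `^ p)%:E)%E.
Proof. by move=> e0; rewrite dpE poweRV_le// hint_ge0. Qed.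

Lemma FB_cut u : FB p u <-> [/\ normal_fuzzy u, upper_semicontinuous u &
  (hint p 0 1 (cut u) zero < +oo)%E].
Proof.
rewrite /FB /Lp_from /=.
have -> : (\int[lebesgue_measure]_(al in `[0%R, 1%R])
    hausdorff_dist (alpha_cut u al) [set 0%R] `^ p)%E = hint p 0 1 (cut u) zero.
  apply: eq_integral => al.
  by rewrite inE /= in_itv /= => /andP[_ al1]; rewrite !cut_le1.
split=> -[? ? h]; split => //; last exact: poweR_lty.
by apply: lty_poweRy h; rewrite invr_eq0 gt_eqF.
Qed.

Lemma uniformly_p_mean_boundedP (U : set (fuzzy_set R m)) :
  uniformly_p_mean_bounded p U <->
  exists M : R, forall u, U u -> (hint p 0 1 (cut u) zero <= M%:E)%E.
Proof.
have dp0 u : hint p 0 1 (cut u) (cut (hat0 R m)) = hint p 0 1 (cut u) zero.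
  by apply: hint_eq => // al /andP[_ al1]; exact: cut_hat0.
split=> [[M M0 hM]|[M hM]].
  by exists (M `^ p) => u /hM; rewrite (dp_le _ _ (ltW M0)) dp0.
pose N := Num.max M 1; have N0 : 0 < N by rewrite lt_max ltr01 orbT.
exists (N `^ p^-1); first by rewrite powR_gt0.
move=> u /hM uM; rewrite dp_le ?powR_ge0// dp0 powRKV ?(ltW N0)//.
by apply: (le_trans uM); rewrite lee_fin le_max lexx.
Qed.

Let Lp_fromE u h : 0 <= h ->
  Lp_from p h (fun al => hausdorff_dist (alpha_cut u al) (alpha_cut u (al - h))) =
  (hint p h 1 (cut u) (fun al => cut u (al - h)%R) `^ p^-1)%E.
Proof.
move=> h0; rewrite /Lp_from; congr (_ `^ _)%E; apply: eq_integral => al.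
rewrite inE /= in_itv /= => /andP[_ al1]; rewrite !cut_le1//.
by apply: le_trans al1; rewrite gerBl.
Qed.

Lemma p_mean_equi_left_continuousP (U : set (fuzzy_set R m)) :
  p_mean_equi_left_continuous p U <->
  forall e : R, 0 < e -> exists2 d : R, 0 < d & forall h : R, 0 <= h < d ->
    forall u, U u -> (hint p h 1 (cut u) (fun al => cut u (al - h)%R) <= e%:E)%E.
Proof.
split=> equi e e0.
  have e'0 : 0 < e `^ p^-1 by rewrite powR_gt0.
  have [d d0 hd] := equi _ e'0; exists d => // h hhd u /(hd h hhd).
  have /andP[h0 _] := hhd.
  by rewrite Lp_fromE// => /ltW; rewrite poweRV_le ?hint_ge0 ?powR_ge0//
    powRKV ?(ltW e0).
(* Halving [e] recovers the strict inequality of the definition. *)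
have e'0 : 0 < (e / 2) `^ p by rewrite powR_gt0// divr_gt0.
have [d d0 hd] := equi _ e'0; exists d => // h hhd u /(hd h hhd).
have /andP[h0 _] := hhd.
rewrite Lp_fromE// -poweRV_le ?hint_ge0 ?divr_ge0// ?(ltW e0)//.
by move=> /le_lt_trans; apply; rewrite lte_fin ltr_pdivrMr// ltr_pMr// ltr1n.
Qed.

(** If [w' x < b < w x], semicontinuity gives a ball of radius [e] around [x] where [w' < b]. At the
    levels in [[b, w x]] the cut of [w] contains [x] and that of [w'] misses the ball, so the
    integral is at least [e^p * (w x - b)]. *)
Lemma hint_cut_eq0 u v : normal_fuzzy u -> normal_fuzzy v ->
  upper_semicontinuous u -> upper_semicontinuous v ->
  (forall e, 0 < e -> (hint p 0 1 (cut u) (cut v) <= e%:E)%E) -> u = v.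
Proof.
have le w w' : normal_fuzzy w -> normal_fuzzy w' -> upper_semicontinuous w' ->
    (forall e, 0 < e -> (hint p 0 1 (cut w) (cut w') <= e%:E)%E) ->
    forall x, w x <= w' x.
  move=> nw nw' uw' h x; rewrite leNgt; apply/negP => xlt.
  have [nw0 _] := nested_cut nw; have [nw'0 _] := nested_cut nw'.
  pose b := (w x + w' x) / 2.
  have /andP[w1 w2] := memb_itv w x; have /andP[w'1 w'2] := memb_itv w' x.
  have b0 : 0 < b by rewrite /b; lra.
  have bw : b < w x by rewrite /b; lra.
  have : w' x < b by rewrite /b; lra.
  move=> /uw'/nbhs_eucl_distP[e e0 he].
  have : ((e `^ p * (w x - b))%:E <= hint p b (w x) (cut w) (cut w'))%E.
    apply: hint_ge_cst => //;
      [exact: nested_cut|exact: nested_cut|exact: ltW|exact: ltW|].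
    move=> al /andP[bal alw]; have al01 : 0 < al <= 1.
      by rewrite (lt_le_trans b0)//= (le_trans alw).
    apply: (@le_trans _ _ (setdist (cut w' al) x)%:E); last first.
      by apply: setdist_le_hausdorff => //; rewrite cutE.
    rewrite lee_fin; apply: le_setdist => // y; rewrite cutE//= => aly.
    rewrite leNgt; apply/negP => /he; rewrite ltNge => /negP; apply.
    exact: le_trans aly.
  have : (hint p b (w x) (cut w) (cut w') <= hint p 0 1 (cut w) (cut w'))%E.
    by apply: hint_subset; [exact: nested_cut|exact: nested_cut|exact: ltW|].
  have c0 : 0 < e `^ p * (w x - b) by rewrite mulr_gt0 ?powR_gt0// subr_gt0.
  have c20 : 0 < e `^ p * (w x - b) / 2 by rewrite divr_gt0.
  move=> /[swap] /le_trans/[apply] /le_trans/(_ (h _ c20)).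
  by rewrite lee_fin; lra.
move=> nu nv uu uv h; have uvE : memb u = memb v.
  apply/funext => x; apply/le_anti; rewrite le//= le// => e /h.
  by rewrite hintC.
case: u v uvE {h uu uv nu nv} => [u pu] [v pv] /= uv.
by case: _ / uv pv => pv; congr FuzzySet; exact: Prop_irrelevance.
Qed.

End cuts.

(** * Neighbourhoods in terms of the integrals *)

Section dp_topology.
Context (R : realType) (m : nat) (p : R) (p1 : 1 <= p).
Context (X : set (fuzzy_set R m)) (XFB : X `<=` FB p).

Let p0 : 0 < p. Proof. exact: lt_le_trans p1. Qed.

Lemma nested_dp_space (u : dp_space p X) : nested (cut (sval u)).
Proof. by apply: nested_cut; have [] := XFB (svalP u). Qed.

Lemma nbhs_dpP (u : dp_space p X) (A : set (dp_space p X)) :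
  nbhs u A <-> exists2 e : R, 0 < e & forall v : dp_space p X,
    (hint p 0 1 (cut (sval u)) (cut (sval v)) <= e%:E)%E -> A v.
Proof.
split=> [[B [oB Bu BA]]|[e e0 he]].
  have [e e0 he] := oB u Bu; exists ((e / 2) `^ p).
    by rewrite powR_gt0// divr_gt0.
  move=> v; rewrite -dp_le ?divr_ge0 ?(ltW e0)// => uv; apply/BA/he.
  by apply: (le_lt_trans uv); rewrite lte_fin ltr_pdivrMr// ltr_pMr// ltr1n.
(* [B] is the candidate for the interior of [A]; the weak triangle inequality shows that it is
   open. *)
pose B := [set w : dp_space p X | exists2 d : R, 0 < d & forall v : dp_space p X,
  (hint p 0 1 (cut (sval w)) (cut (sval v)) <= d%:E)%E -> A v].
exists B; split; [|by exists e|]; last first.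
  move=> w [d d0 hd]; apply: hd; rewrite hint_refl ?lee_fin ?ltW//.
  exact: nested_dp_space.
move=> w [d d0 hd]; have K0 : 0 < 2 `^ p :> R by rewrite powR_gt0.
pose d' := d / (2 * 2 `^ p); have d'0 : 0 < d' by rewrite divr_gt0// mulr_gt0.
exists (d' `^ p^-1); first by rewrite powR_gt0.
move=> v /ltW; rewrite dp_le ?powR_ge0// powRKV ?(ltW d'0)// => wv.
exists d' => // z vz; apply: hd.
have -> : d = 2 `^ p * (d' + d') by rewrite /d'; field; rewrite gt_eqF.
by apply: hint_triangle_le wv vz => //; exact: nested_dp_space.
Qed.

Lemma near_dp (u : dp_space p X) (e : R) : 0 < e ->
  \forall v \near u, (hint p 0 1 (cut (sval u)) (cut (sval v)) <= e%:E)%E.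
Proof. by move=> e0; apply/nbhs_dpP; exists e. Qed.

End dp_topology.

(** * Compact sets are bounded, equi-left-continuous and closed *)

Section necessity.
Context (R : realType) (m : nat) (p : R) (p1 : 1 <= p).
Context (X U : set (fuzzy_set R m)) (XFB : X `<=` FB p) (UX : U `<=` X).
Hypothesis cU : compact (in_space p X U).

Let p0 : 0 < p. Proof. exact: lt_le_trans p1. Qed.

Local Notation zero := (fun=> [set (0 : 'rV[R]_m)]).

(** A finite bound [r] at [u] becomes [2^p (1 + r)] on a neighbourhood; compactness, with [M]
    tending to infinity, makes the bound uniform. *)
Lemma compact_uniformly_p_mean_bounded : uniformly_p_mean_bounded p U.
Proof.
apply/(uniformly_p_mean_boundedP p1).
have [|M [_ hM]] := (compact_near_coveringP _).1 cU R (pinfty_nbhs R)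
    (fun M u => (hint p 0 1 (cut (sval u)) zero <= M%:E)%E) _.
  move=> u Uu; have nu := nested_dp_space XFB u.
  have [_ _ fu] := (FB_cut p1 _).1 (XFB (svalP u)).
  have /fineK hu : hint p 0 1 (cut (sval u)) zero \is a fin_num.
    by rewrite ge0_fin_numE// hint_ge0.
  pose r := fine (hint p 0 1 (cut (sval u)) zero).
  exists ([set v | hint p 0 1 (cut (sval u)) (cut (sval v)) <= 1%:E]%E,
          [set M | 2 `^ p * (1 + r) <= M]) => /=.
    split; first exact: near_dp.
    by exists (2 `^ p * (1 + r)); split; [exact: num_real|move=> M /ltW].
  move=> [v M] /= [uv rM]; apply: (@le_trans _ _ (2 `^ p * (1 + r))%:E); last first.
    by rewrite lee_fin.
  apply: (hint_triangle_le p0 (nested_dp_space XFB v) nu (nested0 R m)).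
    by rewrite hintC.
  by rewrite hu.
exists (M + 1) => u Uu.
by apply: (hM (M + 1) _ (exist _ u (UX Uu))) => //; rewrite ltrDl.
Qed.

(** Left continuity at [w] passes to nearby [u] by comparing [u], [w], the shift of [w] and the
    shift of [u]; compactness, with [h] tending to 0, makes it uniform. *)
Lemma compact_p_mean_equi_left_continuous : p_mean_equi_left_continuous p U.
Proof.
apply/(p_mean_equi_left_continuousP p1) => e e0.
pose K : R := 2 `^ p; have K0 : 0 < K by rewrite powR_gt0.
(* Two applications of the weak triangle inequality give [K * (e' + K * (e' + e'))], which is
   [e]. *)
pose e' := e / (K * (1 + K * 2)).
have e'0 : 0 < e' by rewrite divr_gt0// mulr_gt0// addr_gt0// mulr_gt0.
have [|d /= d0 hd] := (compact_near_coveringP _).1 cU R (nbhs (0 : R))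
    (fun h u => 0 <= h <= 1 ->
      (hint p h 1 (cut (sval u)) (fun al => cut (sval u) (al - h)%R) <= e%:E)%E) _.
  move=> w Uw; have nw := nested_dp_space XFB w.
  have [_ _ fw] := (FB_cut p1 _).1 (XFB (svalP w)).
  have [d d0 hd] := hint_shift_cvg0 p1 nw fw e'0.
  exists ([set v | hint p 0 1 (cut (sval w)) (cut (sval v)) <= e'%:E]%E,
          [set h | h < d]) => /=.
    by split; [exact: near_dp|exact: lt_nbhsl].
  move=> [u h] /= [wu hltd] /andP[h0 h1]; have nu := nested_dp_space XFB u.
  have nuh : nested (fun al => cut (sval u) (al - h)) by exact: (nested_shift (- h)).
  have nwh : nested (fun al => cut (sval w) (al - h)) by exact: (nested_shift (- h)).
  have -> : e = K * (e' + K * (e' + e')).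
    rewrite /e'; field; apply/andP; split; rewrite gt_eqF// ?addr_gt0// mulr_gt0//.
  apply: (hint_triangle_le p0 nu nw nuh).
    by rewrite hintC; apply: le_trans wu; exact: hint_subset.
  apply: (hint_triangle_le p0 nw nwh nuh); first by apply: hd; rewrite h0.
  have := hint_shift p h 0 (1 - h) nw nu; rewrite add0r subrK => ->.
  by apply: le_trans wu; apply: hint_subset => //; rewrite gerBl.
exists (Num.min d 1); first by rewrite lt_min d0 ltr01.
move=> h /andP[h0]; rewrite lt_min => /andP[hltd h1] u Uu.
apply: (hd h _ (exist _ u (UX Uu))) => //.
  by rewrite /ball /= sub0r normrN ger0_norm.
by rewrite h0 ltW.
Qed.

(** A point [w] of the closure need not lie in [X] a priori. The traces on [U] of the balls around
    [w] still generate a filter on [X]; it clusters at some [u] in [U], and [u = w] because [dp]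
    separates points. *)
Lemma compact_closed_in_FB :
  in_space p (FB p) U = closure (in_space p (FB p) U).
Proof.
apply/seteqP; split; first exact: subset_closure.
have FBFB : FB p `<=` FB (m := m) p by [].
move=> w clw; have nw := nested_dp_space FBFB w.
pose S (e : R) := [set u : dp_space p X | U (sval u) /\
  (hint p 0 1 (cut (sval w)) (cut (sval u)) <= e%:E)%E].
pose G : set_system (dp_space p X) := filter_from [set e : R | 0 < e] S.
have GF : ProperFilter G.
  apply: filter_from_proper; last first.
    move=> e /= e0; have /clw[u [Uu wu]] := near_dp p1 FBFB w e0.
    by exists (exist _ (sval u) (UX Uu)).
  apply: filter_from_filter; first by exists 1 => /=.
  move=> d e /= d0 e0; exists (Num.min d e); first by rewrite /= lt_min d0.
  move=> u [Uu]; rewrite EFin_min le_min => /andP[? ?]; by split.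
have [|u [Uu clu]] := cU GF; first by exists 1 => //= u [].
suff uwE : sval u = sval w by rewrite /in_space /= -uwE.
have [nu uu _] := XFB (svalP u); have [nw' uw _] := svalP w.
apply: (hint_cut_eq0 p1) => // e e0.
pose e' := e / (2 * 2 `^ p).
have e'0 : 0 < e' by rewrite divr_gt0// mulr_gt0 ?powR_gt0.
have [v [[Uv wv] uv]] : S e' `&`
    [set v | hint p 0 1 (cut (sval u)) (cut (sval v)) <= e'%:E]%E !=set0.
  by apply: clu; [exists e'|exact: near_dp].
have -> : e = 2 `^ p * (e' + e') by rewrite /e'; field; rewrite gt_eqF// powR_gt0.
have nv := nested_dp_space XFB v; have nu' := nested_dp_space XFB u.
by apply: (hint_triangle_le p0 nu' nv nw uv); rewrite hintC.
Qed.

End necessity.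

(** * Limits along ultrafilters *)

(** A cluster point is a limit: were a neighbourhood not in the image ultrafilter, its complement
    would be, and it would have to meet the neighbourhood. *)
Lemma ultra_compact_cvg (T : Type) (F : set_system T) (X : topologicalType)
    (f : T -> X) (K : set X) : UltraFilter F -> compact K ->
  (\forall t \near F, K (f t)) -> exists x : X, f t @[t --> F] --> x.
Proof.
move=> FU cK FK; have [x [_ clx]] := cK (f @ F) _ FK.
exists x => B xB; have [//|FnB] := in_ultra_setVsetC (f @^-1` B) FU.
by have [y [/= nBy By]] := clx (~` B) B FnB xB.
Qed.

Section ultralimit.
Context (R : realType) (m : nat) (T : Type) (F : set_system T).
Context (FU : UltraFilter F) (A : T -> R -> set 'rV[R]_m).
Hypothesis nA : forall t, nested (A t).
Hypothesis bndA : forall al, 0 < al <= 1 ->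
  exists r, \forall t \near F, forall x, A t al x -> eucl_dist x 0 <= r.

Let FF : ProperFilter F. Proof. exact: ultra_proper. Qed.

(** For levels in []0, 1]] the limit exists, by the boundedness [bndA]. *)
Let l (c : 'rV[R]_m) (al : R) : R := lim (setdist (A t al) c @[t --> F]).

Let cvg_l c al : 0 < al <= 1 -> setdist (A t al) c @[t --> F] --> l c al.
Proof.
move=> /bndA[r Fr].
have [|y cvy] := ultra_compact_cvg (f := fun t => setdist (A t al) c) FU
    (@segment_compact R 0 (eucl_dist c 0 + r)).
  apply: filterS Fr => t Ar; have [/(_ al)[x Ax] _] := nA t.
  rewrite /= in_itv/= setdist_ge0; last by exists x.
  apply: (le_trans (setdist_le c Ax)); apply: (le_trans (eucl_dist_triangle 0 _ _)).
  by rewrite lerD2l eucl_distC Ar.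
by rewrite /l (cvg_lim _ cvy).
Qed.

Let near_l c al e : 0 < al <= 1 -> 0 < e ->
  \forall t \near F, `|setdist (A t al) c - l c al| < e.
Proof.
move=> al01 e0; have /cvgrPdist_lt/(_ _ e0) := @cvg_l c al al01.
by apply: filterS => t; rewrite distrC.
Qed.

Let l_ge0 c al : 0 < al <= 1 -> 0 <= l c al.
Proof.
move=> al01; apply/ler_addgt0Pr => e e0; have [t] := filter_ex (near_l c al01 e0).
have [A0 _] := nA t; have := setdist_ge0 c (A0 al).
by rewrite ltr_norml => ? /andP[? ?]; lra.
Qed.

Let l_triangle c d al : 0 < al <= 1 -> l c al <= eucl_dist c d + l d al.
Proof.
move=> al01; apply/ler_addgt0Pr => e e0; have e20 : 0 < e / 2 by rewrite divr_gt0.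
have [t []] := filter_ex (filterI (near_l c al01 e20) (near_l d al01 e20)).
have [A0 _] := nA t; have := setdist_triangle c d (A0 al).
by rewrite !ltr_norml => ? /andP[? ?] /andP[? ?]; lra.
Qed.

Let l_mono c al be : 0 < al -> al <= be <= 1 -> l c al <= l c be.
Proof.
move=> al0 /andP[albe be1]; have al01 : 0 < al <= 1 by rewrite al0 (le_trans albe).
have be01 : 0 < be <= 1 by rewrite (lt_le_trans al0).
apply/ler_addgt0Pr => e e0; have e20 : 0 < e / 2 by rewrite divr_gt0.
have [t []] := filter_ex (filterI (near_l c al01 e20) (near_l c be01 e20)).
have [A0 dA] := nA t; have := setdist_subset c (A0 be) (dA _ _ albe).
by rewrite !ltr_norml => ? /andP[? ?] /andP[? ?]; lra.
Qed.

(** Near-minimisers in [A t al] of the distance to [c] stay in a compact cube and converge along [F]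
    to a zero of [l _ al]. With [l_triangle], this makes [l _ al] the distance function of its zero
    set. *)
Let l_attained c al e : 0 < al <= 1 -> 0 < e ->
  exists2 x, l x al = 0 & eucl_dist c x <= l c al + e.
Proof.
move=> al01 e0; have e20 : 0 < e / 2 by rewrite divr_gt0.
have [r Fr] := bndA al01.
have /choice[x_ hx] : forall t, exists x, A t al x /\
    eucl_dist c x < setdist (A t al) c + e / 2.
  move=> t; have [A0 _] := nA t.
  have [|x Ax cx] := @setdist_lt _ _ _ c (setdist (A t al) c + e / 2) (A0 al).
    by rewrite ltrDl.
  by exists x.
have cK : compact [set x : 'rV[R]_m | forall i, `[- r, r]%classic (x ord0 i)].
  by apply: (@rV_compact _ _ (fun=> `[- r, r]%classic)) => _; exact: segment_compact.
have [|x cvx] := ultra_compact_cvg (f := x_) FU cK.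
  apply: filterS Fr => t Ar i; rewrite /= in_itv /= -ler_norml.
  have := Ar _ (hx t).1; apply: le_trans.
  by have := le_coord_eucl_dist (x_ t) 0 i; rewrite mxE subr0.
have near_x d : 0 < d -> \forall t \near F, eucl_dist x (x_ t) < d.
  by move=> d0; apply: (cvx [set y | eucl_dist x y < d]);
    apply/nbhs_eucl_distP; exists d.
exists x.
  apply/eqP; rewrite eq_le l_ge0// andbT; apply/ler_addgt0Pr => d d0.
  have d20 : 0 < d / 2 by rewrite divr_gt0.
  have [t []] := filter_ex (filterI (near_l x al01 d20) (near_x _ d20)).
  have := setdist_le x (hx t).1.
  by rewrite ltr_norml => ? /andP[? ?] ?; lra.
apply/ler_addgt0Pr => d d0; have d20 : 0 < d / 2 by rewrite divr_gt0.
have [t []] := filter_ex (filterI (near_l c al01 e20) (near_x _ d0)).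
have := eucl_dist_triangle (x_ t) c x; have := (hx t).2.
by rewrite ltr_norml [eucl_dist x _]eucl_distC => ? ? /andP[? ?] ?; lra.
Qed.

(** The levels at which [x] is in the limit set; 0 is adjoined to make the set nonempty. The
    supremum is the membership degree of [x] in the limit. *)
Let S (x : 'rV[R]_m) : set R := [set al | al = 0 \/ 0 < al <= 1 /\ l x al = 0].

Let S_le1 x al : S x al -> al <= 1.
Proof. by move=> [->|[/andP[]]]. Qed.

Let hS x : has_sup (S x).
Proof. by split; [exists 0; left|exists 1 => al; exact: S_le1]. Qed.

Let S_sup x al : S x al -> al <= sup (S x).
Proof. by move=> Sx; apply: ub_le_sup => //; case: (hS x). Qed.

Let v_itv x : 0 <= sup (S x) <= 1.
Proof.
apply/andP; split; first by apply: S_sup; left.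
by apply: ge_sup; [case: (hS x)|move=> al; exact: S_le1].
Qed.

Let v : fuzzy_set R m := FuzzySet v_itv.

(** By [l_mono], [S x] is an interval starting at 0. The cut of [v] is thus the intersection of the
    zero sets at lower levels, and may exceed the zero set at [al] itself. *)
Let le_v x al : 0 < al <= 1 ->
  (al <= v x) <-> (forall be, 0 < be < al -> l x be = 0).
Proof.
move=> /andP[al0 al1]; split=> [alv be /andP[be0 beal]|h].
  have d0 : 0 < al - be by rewrite subr_gt0.
  have [s Ss ls] := sup_adherent d0 (hS x).
  have bes : be < s by have : al <= sup (S x) := alv; lra.
  case: Ss => [s0|[/andP[s0 s1] ls0]]; first by move: bes; rewrite s0 ltNge (ltW be0).
  apply/eqP; rewrite eq_le l_ge0 ?be0 ?(le_trans (ltW beal))// andbT -ls0.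
  by apply: l_mono => //; rewrite (ltW bes).
rewrite leNgt; apply/negP => /= sal.
have /andP[s0 _] := v_itv x.
have : S x ((sup (S x) + al) / 2).
  right; split; first by apply/andP; split; lra.
  by apply: h; apply/andP; split; lra.
by move=> /S_sup; lra.
Qed.

Let normal_v : normal_fuzzy v.
Proof.
have [|x lx _] := l_attained 0 (_ : 0 < 1 <= 1) (ltr01 : 0 < 1 :> R).
  by rewrite ltr01 lexx.
exists x; apply/le_anti/andP; split; first by have /andP[] := v_itv x.
by apply: S_sup; right; rewrite ltr01 lexx.
Qed.

Let usc_v : upper_semicontinuous v.
Proof.
move=> x a xa; have [a1|a1] := ltP 1 a.
  by apply/nbhs_eucl_distP; exists 1 => // y _; apply: le_lt_trans a1;
    have /andP[] := v_itv y.
have a0 : 0 < a by apply: le_lt_trans xa; have /andP[] := v_itv x.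
have a01 : 0 < a <= 1 by rewrite a0.
have [be /andP[be0 bea] lx] : exists2 be, 0 < be < a & l x be != 0.
  apply: contrapT => h; move: xa; rewrite ltNge => /negP; apply.
  apply/(le_v x a01) => be bea; apply: contrapT => /eqP lx; apply: h.
  by exists be.
have be01 : 0 < be <= 1 by rewrite be0 (le_trans (ltW bea)).
(* As [l _ be] is 1-Lipschitz, it has no zero within [l x be] of [x]. *)
apply/nbhs_eucl_distP; exists (l x be); first by rewrite lt_neqAle eq_sym lx l_ge0.
move=> y xy; rewrite ltNge; apply/negP => /(le_v y a01)/(_ be).
rewrite be0 bea => /(_ isT) ly; have := l_triangle x y be01.
by rewrite ly; lra.
Qed.

(** Where [l] jumps in the level, it may differ from the distance function of the cut. The two are
    therefore compared at distinct levels, as [hint_cvg0] expects. *)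
Lemma ultralimit_fuzzy_set : exists v : fuzzy_set R m,
  [/\ normal_fuzzy v, upper_semicontinuous v,
    forall al, 0 < al <= 1 -> exists r, forall x, cut v al x -> eucl_dist x 0 <= r &
    exists l : 'rV[R]_m -> R -> R, [/\
      forall c al, 0 < al <= 1 -> setdist (A t al) c @[t --> F] --> l c al,
      forall c be al, 0 < be -> be < al <= 1 -> l c be <= setdist (cut v al) c &
      forall c al ga, 0 < al < ga -> ga <= 1 -> setdist (cut v al) c <= l c ga]].
Proof.
have cutP al x : 0 < al <= 1 -> cut v al x <-> forall be, 0 < be < al -> l x be = 0.
  by move=> al01; rewrite cutE//; exact: le_v.
have [v0 dv] := nested_cut normal_v.
exists v; split=> //.
  move=> al al01; have /andP[al0 al1] := al01.
  have al201 : 0 < al / 2 <= 1 by apply/andP; split; lra.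
  (* A point of the cut at [al] is a zero of [l] at level [al / 2], hence within 1 of some
     [A t (al / 2)] bounded by [r]. *)
  have [r Fr] := bndA al201; exists (r + 1) => x /(cutP _ _ al01)/(_ (al / 2)) lx.
  have {}lx : l x (al / 2) = 0 by apply: lx; apply/andP; split; lra.
  have [t []] := filter_ex (filterI (near_l x al201 ltr01) Fr).
  rewrite lx subr0 => lt1 Ar; have [A0 _] := nA t.
  have [y Ay xy] := setdist_lt (A0 _) (le_lt_trans (ler_norm _) lt1).
  by have := eucl_dist_triangle y x 0; have := Ar _ Ay; lra.
exists l; split => //.
- move=> c be al be0 /andP[beal al1]; apply: le_setdist => // x.
  have al01 : 0 < al <= 1 by rewrite (lt_trans be0).
  move=> /(cutP _ _ al01)/(_ be); rewrite be0 beal => /(_ isT) lx.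
  have be01 : 0 < be <= 1 by rewrite be0 (le_trans (ltW beal)).
  by have := l_triangle c x be01; rewrite lx addr0.
- move=> c al ga /andP[al0 alga] ga1; have ga01 : 0 < ga <= 1 by rewrite (lt_trans al0).
  have al01 : 0 < al <= 1 by rewrite al0 (le_trans (ltW alga)).
  apply/ler_addgt0Pr => e e0; have [x lx cx] := l_attained c ga01 e0.
  apply: le_trans cx; apply: setdist_le; apply/(cutP _ _ al01) => be /andP[be0 beal].
  have bega := lt_trans beal alga.
  apply/eqP; rewrite eq_le l_ge0 ?be0 ?(le_trans (ltW bega))// andbT -lx.
  by apply: l_mono => //; rewrite ltW.
Qed.

End ultralimit.

(** * Bounded, equi-left-continuous and closed sets are compact *)

Section sufficiency.
Context (R : realType) (m : nat) (p : R) (p1 : 1 <= p).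
Context (X U : set (fuzzy_set R m)) (XFB : X `<=` FB p) (UX : U `<=` X).

Let p0 : 0 < p. Proof. exact: lt_le_trans p1. Qed.

Local Notation zero := (fun=> [set (0 : 'rV[R]_m)]).

Hypothesis bU : uniformly_p_mean_bounded p U.
Hypothesis eU : p_mean_equi_left_continuous p U.

Let K : R := 2 `^ p.
Let K0 : 0 < K. Proof. by rewrite powR_gt0. Qed.

(* Near the level 0, compare [u]_al with [u]_(al + h) by equi-left-continuity;
   the latter is bounded in terms of h alone. *)
Lemma hint_near0_uniform (e : R) : 0 < e -> exists2 d, 0 < d < 1 &
  forall u, U u -> (hint p 0 d (cut u) zero <= e%:E)%E.
Proof.
move=> e0; have [M1 hM1] := (uniformly_p_mean_boundedP p1 U).1 bU.
pose M := Num.max M1 0; have M0 : 0 <= M by rewrite le_max lexx orbT.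
have hM u : U u -> (hint p 0 1 (cut u) zero <= M%:E)%E.
  by move=> /hM1 /le_trans; apply; rewrite lee_fin le_max lexx.
pose e' := e / (K * 2); have e'0 : 0 < e' by rewrite divr_gt0// mulr_gt0.
have [d d0 hd] := (p_mean_equi_left_continuousP p1 U).1 eU _ e'0.
(* Both [h] and [dl] are at most [1 / 2], so [[0, dl]] shifted by [h] stays in [[h, 1]]. *)
pose h := Num.min d 1 / 2.
have d1 : Num.min d 1 <= d by rewrite ge_min lexx.
have d2 : Num.min d 1 <= 1 by rewrite ge_min lexx orbT.
have d3 : 0 < Num.min d 1 by rewrite lt_min d0 ltr01.
have h0 : 0 < h by rewrite /h; lra.
have hltd : h < d by rewrite /h; lra.
have h12 : h <= 1 / 2 by rewrite /h; lra.
(* At levels above [h] the integrand is at most [M / h], by [nested_bounded]; [dl] makes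
   [M / h * dl] at most [e'], and [M + 1] avoids a zero denominator. *)
pose dl := Num.min (1 / 2) (e' * h / (M + 1)).
have M10 : 0 < M + 1 by rewrite ltr_wpDl.
have dl0 : 0 < dl by rewrite lt_min !divr_gt0// mulr_gt0.
have dl12 : dl <= 1 / 2 by rewrite ge_min lexx.
have dlM : M / h * dl <= e'.
  apply: (@le_trans _ _ (M / h * (e' * h / (M + 1)))).
    by apply: ler_wpM2l; [rewrite divr_ge0// ltW|rewrite ge_min lexx orbT].
  have -> : M / h * (e' * h / (M + 1)) = e' * M / (M + 1).
    by field; rewrite !gt_eqF.
  by rewrite ler_pdivrMr// ler_pM2l// lerDl.
exists dl; first by apply/andP; split; lra.
move=> u Uu; have nu : nested (cut u).
  by apply: nested_cut; have [] := XFB (UX Uu).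
have nuh : nested (fun al => cut u (al + h)) by exact: nested_shift.
have nuh' : nested (fun al => cut u (al - h)) by exact: (nested_shift (- h)).
have n0 := nested0 R m.
have -> : e = K * (e' + e') by rewrite /e'; field; rewrite gt_eqF.
apply: (hint_triangle_le p0 nu nuh n0).
  rewrite -(hint_shift p h 0 dl nu nuh) add0r hintC.
  rewrite (hint_eq p (A' := cut u) (B' := fun al => cut u (al - h)))//; last first.
    by move=> al _; rewrite subrK.
  apply: le_trans (hint_subset p nu nuh' (lexx h) _) (hd h _ u Uu).
    lra.
  by rewrite (ltW h0).
have h01 : 0 < h <= 1 by rewrite h0; lra.
apply: (@le_trans _ _ (M / h * (dl - 0))%:E); last by rewrite subr0 lee_fin.
apply: hint_le_cst => //; first exact: ltW.
move=> al /andP[al0 _].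
have bnd : (hausdorff_dist (cut u (al + h)%R) [set 0%R] <= ((M / h) `^ p^-1)%:E)%E.
  have [uh0 _] := nuh; apply: hausdorff_dist0_le => // x ux; rewrite lee_fin.
  apply: (nested_bounded p0 nu (hM u Uu) h01).
  by have [_ du] := nu; apply: du ux; rewrite lerDr ltW.
have := hausdorff_dist_ge0 (nuh.1 al) (n0.1 al).
case: (hausdorff_dist _ _) bnd => [x| |]//; rewrite !lee_fin => xM x0.
by rewrite -(powRKV p0 (divr_ge0 M0 (ltW h0))) ler_powR_iff// powR_ge0.
Qed.

Lemma ultra_hint_cvg (F : set_system (dp_space p X)) : UltraFilter F ->
  F (in_space p X U) -> exists2 v : fuzzy_set R m, FB p v &
  forall e, 0 < e -> \forall u \near F,
    (hint p 0 1 (cut (sval u)) (cut v) <= e%:E)%E.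
Proof.
move=> FU FUs; have FF : ProperFilter F := ultra_proper.
have nX (t : dp_space p X) : nested (cut (sval t)) := nested_dp_space XFB t.
have n0 := nested0 R m.
have [M hM] := (uniformly_p_mean_boundedP p1 U).1 bU.
have bnd al : 0 < al <= 1 -> exists r, \forall t \near F, forall x,
    cut (sval t) al x -> eucl_dist x 0 <= r.
  move=> al01; exists ((M / al) `^ p^-1); apply: filterS FUs => t Ut x.
  exact: (nested_bounded p0 (nX t) (hM _ Ut) al01).
have [v [nv uv bv [l [cl lv vl]]]] := ultralimit_fuzzy_set FU nX bnd.
have nvc : nested (cut v) by exact: nested_cut.
have away a e : 0 < a < 1 -> 0 < e -> \forall t \near F,
    (hint p a 1 (cut (sval t)) (cut v) <= e%:E)%E.
  move=> /andP[a0 a1] e0; have a01 : 0 < a <= 1 by rewrite a0 ltW.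
  have [r1 Fr1] := bnd _ a01; have [r2 vr2] := bv _ a01.
  apply: (@hint_cvg0 _ _ p _ F _ (fun t => cut (sval t)) (cut v) l a
    (Num.max r1 r2)) => //.
  - by rewrite ltW.
  - by apply: filterS Fr1 => t h x /h; rewrite le_max => ->.
  - by move=> x /vr2; rewrite le_max orbC => ->.
  - by move=> c al /andP[aal al1]; apply: cl; rewrite (lt_le_trans a0).
  - by move=> c be al abe; apply: lv; exact: lt_le_trans abe.
  - by move=> c al ga /andP[aal alga]; apply: vl; rewrite (lt_le_trans a0).
(* The bound for [v] on [[c, d]] is inherited from one [t] close to [v] on [[c, 1]]. It does not
   depend on [c], so it extends to [[0, d]]. *)
have near0 e : 0 < e -> exists2 d, 0 < d < 1 &
    (forall u, U u -> (hint p 0 d (cut u) zero <= e%:E)%E) /\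
    (hint p 0 d (cut v) zero <= (K * (e + e))%:E)%E.
  move=> e0; have [d d01 hd] := hint_near0_uniform e0; exists d => //.
  split=> //; apply: hint0_le => // a a0; pose c := Num.min a 2^-1.
  have c01 : 0 < c < 1.
    by rewrite lt_min a0 gt_min invr_gt0 ltr0n
    invf_lt1 ?ltr0n// ltr1n orbT.
  have [t [tv Ut]] := filter_ex (filterI (away c e c01 e0) FUs).
  apply: (@le_trans _ _ (hint p c d (cut v) zero)).
    by apply: hint_subset => //; rewrite ge_min lexx.
  have /andP[c0 _] := c01; have /andP[_ d1] := d01.
  apply: (hint_triangle_le p0 nvc (nX t) n0).
    by rewrite hintC; apply: le_trans tv; apply: hint_subset => //; exact: ltW.
  by apply: le_trans (hd _ Ut); apply: hint_subset => //; exact: ltW.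
have cvg e : 0 < e -> \forall u \near F,
    (hint p 0 1 (cut (sval u)) (cut v) <= e%:E)%E.
  (* On [[0, d]] the comparison goes through the origin, with [e'] for [u] and [K * (e' + e')] for
     [v]; [[d, 1]] contributes another [e']. *)
  move=> e0; pose e' := e / (K * (1 + K * 2) + 1).
  have D0 : 0 < K * (1 + K * 2) + 1.
    by rewrite addr_gt0// mulr_gt0// addr_gt0// mulr_gt0.
  have e'0 : 0 < e' by rewrite divr_gt0.
  have [d d01 [Ud vd]] := near0 _ e'0.
  apply: filterS2 (away d e' d01 e'0) FUs => t tv Ut.
  have /andP[d0 d1] := d01.
  rewrite (hint_split p (b := d) (nX t) nvc); last by rewrite !ltW.
  have -> : e = K * (e' + K * (e' + e')) + e' by rewrite /e'; field; rewrite gt_eqF.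
  rewrite EFinD leeD//; apply: (hint_triangle_le p0 (nX t) n0 nvc); first exact: Ud.
  by rewrite hintC.
exists v => //; apply/(FB_cut p1); split => //.
have [t [tv Ut]] := filter_ex (filterI (cvg 1 ltr01) FUs).
apply: (@le_lt_trans _ _ (K * (1 + M))%:E); last exact: ltry.
apply: (hint_triangle_le p0 nvc (nX t) n0); last exact: hM.
by rewrite hintC.
Qed.

Lemma compact_in_space : in_space p (FB p) U = closure (in_space p (FB p) U) ->
  compact (in_space p X U).
Proof.
move=> clU; rewrite compact_ultra => F FU FUs.
have FF : ProperFilter F := ultra_proper.
have [v FBv cvg] := ultra_hint_cvg FU FUs.
(* The limit [v] is only known to lie in [FB p]; closedness of [U] in that space puts it into [U],
   hence into [X]. *)
have Uv : U v.
  suff : in_space p (FB p) U (exist _ v FBv) by [].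
  rewrite clU => B /(nbhs_dpP p1 (fun _ => id))[e e0 he].
  have [t [tv Ut]] := filter_ex (filterI (cvg e e0) FUs).
  exists (exist _ (sval t) (XFB (UX Ut))); split => //.
  by apply: he; rewrite hintC.
exists (exist _ v (UX Uv)); split => // B /(nbhs_dpP p1 XFB)[e e0 he].
by apply: filterS (cvg e e0) => t tv; apply: he; rewrite hintC.
Qed.

End sufficiency.

Theorem theorem6p13 (R : realType) (m : nat) (p : R) (hm : (1 <= m)%N)
    (hp : 1 <= p) (X U : set (fuzzy_set R m))
    (hX : [\/ X = Stilde_mp p, X = E_mp p, X = S0_mp p | X = S_mp p])
    (hU : U `<=` X) :
  compact (in_space p X U) <->
  [/\ uniformly_p_mean_bounded p U,
      p_mean_equi_left_continuous p U &
      in_space p (FB p) U = closure (in_space p (FB p) U)].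
Proof.
have XFB : X `<=` FB p by case: hX => -> u [].
split=> [cU|[bU eU clU]]; last exact: compact_in_space.
split.
- exact: compact_uniformly_p_mean_bounded cU.
- exact: compact_p_mean_equi_left_continuous cU.
- exact: compact_closed_in_FB cU.
Qed.
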